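(* (Weak BV estimates.) Let $T>0$ and let $[\varrho_h,\mathbf m_h,E_h]$, $h\to0$, be a family of solutions on $[0,T]$ of the semi-discrete finite volume scheme (C), (M), (E) described in the context, with admissible initial data ($\varrho_{0,h}>0$, $E_{0,h}-\frac12|\mathbf m_{0,h}|^2/\varrho_{0,h}>0$) whose total mass and total energy $\int_{\Omega_h}\varrho_{0,h}\,dx$, $\int_{\Omega_h}E_{0,h}\,dx$ are bounded uniformly in $h$ and whose entropy satisfies $s_h(0)> s_0$ for a constant $s_0\in\mathbb R$ independent of $h$. Suppose that there are constants $\underline\varrho,\overline\vartheta>0$ independent of $h$ such that $$0<\underline\varrho\le\varrho_h(t),\qquad 0<\vartheta_h(t)\le\overline\vartheta\qquad\text{on }\Omega_h\text{ for all }t\in[0,T].$$ Then, with $\lambda_h=|\overline{\mathbf u_h}\cdot\mathbf n|+\mu_h$, $$h^{\alpha-1}\int_0^T\sum_{\sigma\in\Sigma_{int}}\int_\sigma[[\mathbf u_h]]^2\,dS_h\,dt\lesssim1,\quad \int_0^T\sum_{\sigma\in\Sigma_{int}}\int_\sigma\lambda_h[[\varrho_h]]^2\,dS_h\,dt\lesssim1,\quad \int_0^T\sum_{\sigma\in\Sigma_{int}}\int_\sigma\lambda_h[[\vartheta_h]]^2\,dS_h\,dt\lesssim1,$$ where $A\lesssim B$ means $A\le cB$ with a constant $c>0$ independent of $h$.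
   Context: Mesh. $\Omega_h\subset\mathbb R^N$, $N\in\{1,2,3\}$, is the polyhedral physical domain (regarded as fixed while the mesh size $h\to0$), $\overline{\Omega}_h=\bigcup_{K\in\mathcal T_h}K$ with $\mathcal T_h$ a finite regular mesh of compact elements (two elements share at most a common face, edge or vertex), $|K|\approx h^N$, $|\sigma|\approx h^{N-1}$ for elements $K$ and faces $\sigma$, uniformly in $h$. $\Sigma_{int}$ is the set of interior faces; each face carries a fixed unit normal $\mathbf n$. $Q_h(\Omega_h)$ (resp. $Q_h(\Omega_h;\mathbb R^N)$) is the set of scalar (resp. vector) functions constant on each element. Traces. On $\sigma\in\Sigma_{int}$: $v^{\rm out}(x)=\lim_{\delta\to0+}v(x+\delta\mathbf n)$, $v^{\rm in}(x)=\lim_{\delta\to0+}v(x-\delta\mathbf n)$, $\overline v=\frac12(v^{\rm in}+v^{\rm out})$, $[[v]]=v^{\rm out}-v^{\rm in}$; for vectors $[[\mathbf v]]^2=|[[\mathbf v]]|^2$. For a velocity $\mathbf u$: $Up[r,\mathbf u]=\overline r\,\overline{\mathbf u}\cdot\mathbf n-\frac12|\overline{\mathbf u}\cdot\mathbf n|[[r]]$ (componentwise for vector $r$). Parameters. $\gamma>1$, $c_v=1/(\gamma-1)$, $\alpha$ a fixed real parameter; $\mu_h\ge0$ is a face-wise numerical viscosity, typically $\mu_h=hM(h,\overline{\varrho_h},\overline{\mathbf m_h},\overline{E_h})$ with $M$ continuous. Numerical flux: $F_h(r,\mathbf u)=Up[r,\mathbf u]-\mu_h[[r]]$ (componentwise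 $\mathbf F_h$ for vectors). Scheme (semi-discrete; unknowns $\varrho_h,E_h\in Q_h(\Omega_h)$, $\mathbf m_h\in Q_h(\Omega_h;\mathbb R^N)$ are functions of time $t$), with $\mathbf u_h=\mathbf m_h/\varrho_h$, $p_h=(\gamma-1)\big(E_h-\frac12|\mathbf m_h|^2/\varrho_h\big)$, temperature $\vartheta_h=p_h/\varrho_h$, entropy $s_h=\log(\vartheta_h^{c_v}/\varrho_h)$; solutions satisfy $\varrho_h>0$, $p_h>0$: (C) $\int_{\Omega_h}\frac{d}{dt}\varrho_h\,\Phi\,dx-\sum_{\sigma\in\Sigma_{int}}\int_\sigma F_h(\varrho_h,\mathbf u_h)[[\Phi]]\,dS_h=0$ for all $\Phi\in Q_h(\Omega_h)$; (M) $\int_{\Omega_h}\frac{d}{dt}\mathbf m_h\cdot\boldsymbol\Phi\,dx-\sum_{\sigma\in\Sigma_{int}}\int_\sigma\mathbf F_h(\mathbf m_h,\mathbf u_h)\cdot[[\boldsymbol\Phi]]\,dS_h-\sum_{\sigma\in\Sigma_{int}}\int_\sigma\overline{p_h}\,\mathbf n\cdot[[\boldsymbol\Phi]]\,dS_h=-h^{\alpha-1}\sum_{\sigma\in\Sigma_{int}}\int_\sigma[[\mathbf u_h]]\cdot[[\boldsymbol\Phi]]\,dS_h$ for all $\boldsymbol\Phi\in Q_h(\Omega_h;\mathbb R^N)$; (E) $\int_{\Omega_h}\frac{d}{dt}E_h\,\Phi\,dx-\sum_{\sigma\in\Sigma_{int}}\int_\sigma F_h(E_h,\mathbf u_h)[[\Phi]]\,dS_h-\sum_{\sigma\in\Sigma_{int}}\int_\sigma\overline{p_h}\,[[\Phi\mathbf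 u_h]]\cdot\mathbf n\,dS_h+\sum_{\sigma\in\Sigma_{int}}\int_\sigma\overline{p_h\Phi}\,[[\mathbf u_h]]\cdot\mathbf n\,dS_h=-h^{\alpha-1}\sum_{\sigma\in\Sigma_{int}}\int_\sigma[[\mathbf u_h]]\cdot\overline{\mathbf u_h}\,[[\Phi]]\,dS_h$ for all $\Phi\in Q_h(\Omega_h)$. Boundary conditions: no-flux, $\mathbf u_h\cdot\mathbf n=0$ on every face in $\partial\Omega_h$, with $\varrho_h,p_h$ extrapolated ($\partial\varrho_h/\partial\mathbf n=\partial p_h/\partial\mathbf n=0$). *)

(* Defs.v *)
From HB Require Import structures.
From mathcomp Require Export all_boot all_order all_algebra.
From mathcomp Require Export all_classical all_reals all_analysis.
Export Order.TTheory GRing.Theory Num.Theory.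
Export numFieldNormedType.Exports.

Set Implicit Arguments.
Unset Strict Implicit.
Unset Printing Implicit Defensive.

Local Open Scope classical_set_scope.
Local Open Scope ring_scope.

Definition dotp (R : realType) (N : nat) (x y : 'rV[R]_N) : R :=
  \sum_(i < N) x ord0 i * y ord0 i.

(* N-dimensional Lebesgue measure, as the iterated product (Tonelli) of the
   one-dimensional one.  It is only applied to compact sets. *)
Fixpoint lebN (R : realType) (N : nat) : set 'rV[R]_N -> \bar R :=
  match N with
  | 0 => fun A => (\1_A (0 : 'rV[R]_0))%:E
  | n.+1 => fun A =>
      (\int[@lebesgue_measure R]_x
         lebN [set v : 'rV[R]_n | A (row_mx (x%:M : 'rV[R]_1) v)])%E
  end.

(* (N-1)-dimensional measure of a set S lying in a hyperplane with unit normal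
   n: the N-dimensional measure of the right prism of height 1 over S. *)
Definition flat_area (R : realType) (N : nat) (n : 'rV[R]_N)
    (S : set 'rV[R]_N) : \bar R :=
  lebN [set y | exists2 x, S x & exists2 a : R, 0 <= a <= 1 & y = x + a *: n].

(* A finite conforming polyhedral mesh of Omega.  The faces are the interior
   faces [iface] and the boundary faces [bface].  The fixed unit normal of an
   interior face s points from the element [inn s] into the element [out s];
   the one of a boundary face b of the element [bin b] points out of Omega. *)
Record mesh (R : realType) (N : nat) (Omega : set 'rV[R]_N) := Mesh {
  cell : finType;
  iface : finType;
  bface : finType;
  elem : cell -> set 'rV[R]_N;
  facet : iface + bface -> set 'rV[R]_N;
  normal : iface + bface -> 'rV[R]_N;
  inn : iface -> cell;
  out : iface -> cell;
  bin : bface -> cell;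
  is_face_of : iface + bface -> cell -> bool := fun f K =>
    match f with
    | inl s => (K == inn s) || (K == out s)
    | inr b => K == bin b
    end;
  (* the points of f that belong to no other face *)
  facet_core : iface + bface -> set 'rV[R]_N := fun f =>
    [set x | facet f x /\ forall g, g != f -> ~ facet g x];
  elem_compact : forall K, compact (elem K);
  elem_cover : closure Omega = \bigcup_(K in [set: cell]) elem K;
  elem_boundary : forall K,
    elem K `\` (elem K)° = \bigcup_(f in [set f | is_face_of f K]) facet f;
  facet_compact : forall f, compact (facet f);
  normal_unit : forall f, dotp (normal f) (normal f) = 1;
  facet_flat : forall f, exists b : R,
    forall x, facet f x -> dotp x (normal f) = b;
  facet_overlap : forall f g, f != g ->
    flat_area (normal f) (facet f `&` facet g) = 0%E;
  inn_out_neq : forall s, inn s != out s;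
  iface_interior : forall s, facet_core (inl s) `<=` Omega;
  iface_sides : forall s x, facet_core (inl s) x ->
    \forall d \near 0^'+,
      (elem (inn s))° (x - d *: normal (inl s)) /\
      (elem (out s))° (x + d *: normal (inl s));
  bface_boundary : forall b, facet (inr b) `<=` closure Omega `\` Omega°;
  bface_sides : forall b x, facet_core (inr b) x ->
    \forall d \near 0^'+,
      (elem (bin b))° (x - d *: normal (inr b)) /\
      ~ closure Omega (x + d *: normal (inr b));
  (* Two elements share at most a common face, edge or vertex; as N <= 3, these
     are the nonempty intersections of one or more faces of an element. *)
  elem_conforming : forall K L, K != L ->
    elem K `&` elem L = set0 \/
    exists F G : {set iface + bface},
      [/\ F != finset.set0, G != finset.set0,
          (forall f, f \in F -> is_face_of f K),
          (forall g, g \in G -> is_face_of g L) &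
          elem K `&` elem L = \bigcap_(f in [set f | f \in F]) facet f /\
          elem K `&` elem L = \bigcap_(g in [set g | g \in G]) facet g]
}.

Section mesh_functions.
Variables (R : realType) (N : nat) (Omega : set 'rV[R]_N) (M : mesh Omega).

Definition vol (K : cell M) : R := fine (lebN (elem K)).
Definition area (f : iface M + bface M) : R :=
  fine (flat_area (normal f) (facet f)).

(* |K| ~ h^N and |sigma| ~ h^(N-1), with constants c1, c2 *)
Definition mesh_regular (c1 c2 h : R) : Prop :=
  (forall K, c1 * h ^+ N <= vol K <= c2 * h ^+ N) /\
  (forall f, c1 * h ^+ N.-1 <= area f <= c2 * h ^+ N.-1).

(* An elementwise constant function is the family of its values, indexed by
   the elements, and a facewise constant one is indexed by the faces. *)
Definition int_dom (v : cell M -> R) : R := \sum_K vol K * v K.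
Definition int_faces (g : iface M -> R) : R := \sum_s area (inl s) * g s.

Definition nrm (s : iface M) : 'rV[R]_N := normal (inl s).
Definition jump (V : zmodType) (v : cell M -> V) (s : iface M) : V :=
  v (out s) - v (inn s).
Definition avg (v : cell M -> R) (s : iface M) : R :=
  2^-1 * (v (inn s) + v (out s)).
Definition vavg (v : cell M -> 'rV[R]_N) (s : iface M) : 'rV[R]_N :=
  2^-1 *: (v (inn s) + v (out s)).
Definition avg_n (u : cell M -> 'rV[R]_N) (s : iface M) : R :=
  dotp (vavg u s) (nrm s).
Definition sqnorm (x : 'rV[R]_N) : R := dotp x x.

Definition Up (r : cell M -> R) (u : cell M -> 'rV[R]_N) (s : iface M) : R :=
  avg r s * avg_n u s - 2^-1 * `|avg_n u s| * jump r s.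
Definition vUp (r u : cell M -> 'rV[R]_N) (s : iface M) : 'rV[R]_N :=
  avg_n u s *: vavg r s - (2^-1 * `|avg_n u s|) *: jump r s.

Definition flux (mu : iface M -> R) (r : cell M -> R)
    (u : cell M -> 'rV[R]_N) (s : iface M) : R :=
  Up r u s - mu s * jump r s.
Definition vflux (mu : iface M -> R) (r u : cell M -> 'rV[R]_N)
    (s : iface M) : 'rV[R]_N :=
  vUp r u s - mu s *: jump r s.

Definition velocity (rho : cell M -> R) (m : cell M -> 'rV[R]_N)
  : cell M -> 'rV[R]_N := fun K => (rho K)^-1 *: m K.
Definition pressure (gamma : R) (rho : cell M -> R) (m : cell M -> 'rV[R]_N)
    (E : cell M -> R) : cell M -> R :=
  fun K => (gamma - 1) * (E K - 2^-1 * sqnorm (m K) / rho K).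
Definition temperature (gamma : R) (rho : cell M -> R)
    (m : cell M -> 'rV[R]_N) (E : cell M -> R) : cell M -> R :=
  fun K => pressure gamma rho m E K / rho K.
Definition entropy (gamma : R) (rho : cell M -> R)
    (m : cell M -> 'rV[R]_N) (E : cell M -> R) : cell M -> R :=
  fun K => ln (temperature gamma rho m E K `^ (gamma - 1)^-1 / rho K).

Definition lambda (mu : iface M -> R) (u : cell M -> 'rV[R]_N)
    (s : iface M) : R := `|avg_n u s| + mu s.

Section scheme.
Variables (gamma alpha h : R) (mu : iface M -> R).
Variables (rho : cell M -> R) (m : cell M -> 'rV[R]_N) (E : cell M -> R).
Variables (drho : cell M -> R) (dm : cell M -> 'rV[R]_N) (dE : cell M -> R).
Let u := velocity rho m.
Let p := pressure gamma rho m E.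

Definition continuity_eq : Prop := forall Phi : cell M -> R,
  int_dom (fun K => drho K * Phi K)
  - int_faces (fun s => flux mu rho u s * jump Phi s) = 0.

Definition momentum_eq : Prop := forall Phi : cell M -> 'rV[R]_N,
  int_dom (fun K => dotp (dm K) (Phi K))
  - int_faces (fun s => dotp (vflux mu m u s) (jump Phi s))
  - int_faces (fun s => avg p s * dotp (nrm s) (jump Phi s))
  = - (h `^ (alpha - 1)
       * int_faces (fun s => dotp (jump u s) (jump Phi s))).

Definition energy_eq : Prop := forall Phi : cell M -> R,
  int_dom (fun K => dE K * Phi K)
  - int_faces (fun s => flux mu E u s * jump Phi s)
  - int_faces (fun s =>
      avg p s * dotp (jump (fun K => Phi K *: u K) s) (nrm s))
  + int_faces (fun s =>
      avg (fun K => p K * Phi K) s * dotp (jump u s) (nrm s))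
  = - (h `^ (alpha - 1)
       * int_faces (fun s => dotp (jump u s) (vavg u s) * jump Phi s)).

End scheme.

(* Solutions on [0, T]; the time argument comes first. The extrapolation of rho
   and p across the boundary imposes no condition on the elementwise values. *)
Record is_solution (gamma alpha h T : R) (mu : R -> iface M -> R)
    (rho : R -> cell M -> R) (m : R -> cell M -> 'rV[R]_N)
    (E : R -> cell M -> R) : Prop := IsSolution {
  rho_continuous : forall K, {within `[0, T], continuous (fun t => rho t K)};
  m_continuous : forall K, {within `[0, T], continuous (fun t => m t K)};
  E_continuous : forall K, {within `[0, T], continuous (fun t => E t K)};
  rho_derivable : forall K t, 0 < t < T -> derivable (fun t => rho t K) t 1;
  m_derivable : forall K t, 0 < t < T -> derivable (fun t => m t K) t 1;
  E_derivable : forall K t, 0 < t < T -> derivable (fun t => E t K) t 1;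
  rho_pos : forall t K, 0 <= t <= T -> 0 < rho t K;
  p_pos : forall t K, 0 <= t <= T ->
    0 < pressure gamma (rho t) (m t) (E t) K;
  no_flux : forall t b, 0 <= t <= T ->
    dotp (velocity (rho t) (m t) (bin b)) (normal (inr b)) = 0;
  continuity_sol : forall t, 0 < t < T ->
    continuity_eq (mu t) (rho t) (m t)
      (fun K => derive1 (fun t => rho t K) t);
  momentum_sol : forall t, 0 < t < T ->
    momentum_eq gamma alpha h (mu t) (rho t) (m t) (E t)
      (fun K => derive1 (fun t => m t K) t);
  energy_sol : forall t, 0 < t < T ->
    energy_eq gamma alpha h (mu t) (rho t) (m t) (E t)
      (fun K => derive1 (fun t => E t K) t)
}.

End mesh_functions.

(* Main.v *)
Require Import Defs.
From mathcomp Require Import measurable_realfun ring lra.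

(* Testing the internal energy balance with 1/theta turns the scheme into an
   entropy balance in which every face contributes, for the transport weight w
   into a cell with values (r0, t0) from a neighbour with values (r1, t1),
   w r1 (s1 - s0) plus nonnegative terms built on x - 1 - ln x >= 0, plus the
   viscous heating.  The pressure work cancels because the no-flux condition and
   the Gauss formula sum_f |f| n_f = 0 on each element annihilate the constant
   field u_K.  Hence the minimum of the entropy cannot decrease, so the density is
   bounded above, and the growth of the total entropy, which is controlled by the
   mass and the bounds on rho and theta, dominates the three dissipation terms.

   The Gauss formula on an element K is obtained without boundary regularity:
   for almost every y the segment from y - v to y crosses the facets of K one at
   a time, so 1_K(y - v) - 1_K(y) is the signed number of prisms over facets, in
   direction v, that contain y; integrating in y leaves sum_f |f| n_f.v = 0. *)

Set Implicit Arguments.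
Unset Strict Implicit.
Unset Printing Implicit Defensive.

Local Open Scope classical_set_scope.
Local Open Scope ring_scope.

(** * Iterated integrals *)

(** They are recovered for closed sets, which are jointly measurable and stable under sections and
    affine preimages; this is why the exceptional sets of the geometric argument are all kept
    closed. Linear maps are reduced by Gaussian elimination to one-dimensional substitutions under
    Tonelli, which is enough to compare the prism over a facet in an arbitrary direction with the
    area of the facet.

    In time, the solution is only continuous on [0, T] and differentiable inside, so the entropy
    rate is not known to be integrable and the fundamental theorem of calculus does not apply. Only
    one inequality is used: a measurable nonnegative lower bound of the rate has an integral at most
    the increment of the total entropy. *)

Fixpoint intN (R : realType) (n : nat) : ('rV[R]_n -> \bar R) -> \bar R :=
  match n with
  | 0 => fun f => f 0
  | k.+1 => fun f =>
      (\int[@lebesgue_measure R]_x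
         intN (fun v : 'rV[R]_k => f (row_mx (x%:M : 'rV[R]_1) v)))%E
  end.

Lemma lebN_intN (R : realType) n (A : set 'rV[R]_n) :
  lebN A = intN (fun v => (\1_A v)%:E).
Proof.
elim: n A => [//|n IH] A /=.
by apply: eq_integral => x _; rewrite IH.
Qed.

(* Joint measurability in a parameter x and the n coordinates, which are moved
   one at a time into the parameter space. *)
Fixpoint measN (R : realType) (n : nat) :
    forall d (X : measurableType d), (X -> 'rV[R]_n -> \bar R) -> Prop :=
  match n return forall d (X : measurableType d), (X -> 'rV[R]_n -> \bar R) -> Prop with
  | 0 => fun d X f => measurable_fun [set: X] ((fun x => f x (0 : 'rV[R]_0)) : X -> \bar R)
  | k.+1 => fun d X f =>
      measN (fun (p : X * measurableTypeR R) (v : 'rV[R]_k) =>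
        f p.1 (row_mx (p.2%:M : 'rV[R]_1) v))
  end.
Arguments measN {R n d X}.

Section measN.
Context {R : realType}.
Local Notation mu := (@lebesgue_measure R).

Lemma measN_comp n d d' (X : measurableType d) (Y : measurableType d')
    (phi : X -> Y) (f : Y -> 'rV[R]_n -> \bar R) :
  measurable_fun setT phi -> measN f -> measN (fun x => f (phi x)).
Proof.
elim: n d d' X Y phi f => [|n IH] d d' X Y phi f mphi /=.
  by move=> mf; exact: (measurableT_comp mf mphi).
move=> mf.
apply: (IH _ _ _ _ (fun p : X * measurableTypeR R => (phi p.1, p.2)) _ _ mf).
apply/measurable_fun_pairP; split.
- exact: (measurableT_comp mphi measurable_fst).
- exact: measurable_snd.
Qed.

Lemma intN_ge0 n (f : 'rV[R]_n -> \bar R) :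
  (forall v, 0 <= f v)%E -> (0 <= intN f)%E.
Proof.
elim: n f => [|n IH] f f0 /=; first exact: f0.
by apply: integral_ge0 => x _; apply: IH => v; exact: f0.
Qed.

Lemma measurable_intN n d (X : measurableType d) (f : X -> 'rV[R]_n -> \bar R) :
  (forall x v, 0 <= f x v)%E -> measN f -> measurable_fun setT (fun x => intN (f x)).
Proof.
elim: n d X f => [//|n IH] d X f f0 mf /=.
have /= m2 := IH _ _ _ (fun (p : X * measurableTypeR R) v =>
  f0 p.1 (row_mx (p.2%:M : 'rV_1) v)) mf.
apply: (measurable_fun_fubini_tonelli_F
  (fun p : X * measurableTypeR R => intN (fun v => f p.1 (row_mx (p.2%:M : 'rV_1) v)))) => //.
by move=> p; apply: intN_ge0.
Qed.

(** The parameter space [unit] stands for no parameter; here the first coordinate takes its place,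
    as it does when [intN] peels it off. *)
Lemma measN_unit n (f : 'rV[R]_n.+1 -> \bar R) :
  measN (fun _ : unit => f) ->
  measN (fun (x : measurableTypeR R) v => f (row_mx (x%:M : 'rV[R]_1) v)).
Proof.
apply: (@measN_comp n _ _ (measurableTypeR R)
  (unit * measurableTypeR R)%type (fun x => (tt, x))
  (fun p v => f (row_mx (p.2%:M : 'rV[R]_1) v))).
by apply/measurable_fun_pairP; split; [exact: measurable_cst|exact: measurable_id].
Qed.

Lemma measurable_intN_row n (f : 'rV[R]_n.+1 -> \bar R) :
  (forall v, 0 <= f v)%E -> measN (fun _ : unit => f) ->
  measurable_fun setT
    (fun x : measurableTypeR R => intN (fun v => f (row_mx (x%:M : 'rV[R]_1) v))).
Proof. by move=> f0 /measN_unit; apply: measurable_intN. Qed.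

Lemma measN_section n (f : 'rV[R]_n.+1 -> \bar R) (x : R) :
  measN (fun _ : unit => f) ->
  measN (fun _ : unit => fun v => f (row_mx (x%:M : 'rV[R]_1) v)).
Proof.
move=> /measN_unit.
by apply: (@measN_comp n _ _ unit (measurableTypeR R) (fun=> x)
  (fun x v => f (row_mx (x%:M : 'rV[R]_1) v))).
Qed.

Lemma le_intN n (f g : 'rV[R]_n -> \bar R) :
  (forall v, 0 <= f v)%E -> (forall v, f v <= g v)%E ->
  measN (fun _ : unit => f) -> measN (fun _ : unit => g) -> (intN f <= intN g)%E.
Proof.
elim: n f g => [|n IH] f g f0 fg mf mg /=; first exact: fg.
have g0 v : (0 <= g v)%E by exact: le_trans (fg v).
apply: ge0_le_integral => //.
- by move=> x _; apply: intN_ge0.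
- exact: measurable_intN_row.
- exact: measurable_intN_row.
- by move=> x _; apply: IH => //; exact: measN_section.
Qed.

Lemma measND n d (X : measurableType d) (f g : X -> 'rV[R]_n -> \bar R) :
  measN f -> measN g -> measN (fun x v => f x v + g x v)%E.
Proof.
elim: n d X f g => [|n IH] d X f g /= mf mg; first exact: emeasurable_funD.
exact: IH.
Qed.

Lemma intND n (f g : 'rV[R]_n -> \bar R) :
  (forall v, 0 <= f v)%E -> (forall v, 0 <= g v)%E ->
  measN (fun _ : unit => f) -> measN (fun _ : unit => g) ->
  intN (fun v => f v + g v)%E = (intN f + intN g)%E.
Proof.
elim: n f g => [//|n IH] f g f0 g0 mf mg /=.
rewrite -ge0_integralD //.
- by apply: eq_integral => x _; rewrite IH //; exact: measN_section.
- by move=> x _; apply: intN_ge0.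
- exact: measurable_intN_row.
- by move=> x _; apply: intN_ge0.
- exact: measurable_intN_row.
Qed.

Lemma intN0 n : intN (fun _ : 'rV[R]_n => 0%E) = 0%E.
Proof. by elim: n => [//|n IH] /=; under eq_integral do rewrite IH; rewrite integral0. Qed.

Lemma measN_cst n d (X : measurableType d) (k : \bar R) :
  measN (fun (_ : X) (_ : 'rV[R]_n) => k).
Proof. by elim: n d X => [|n IH] d X /=; [exact: measurable_cst|exact: IH]. Qed.

Lemma measN_sum n d (X : measurableType d) (I : Type) (s : seq I)
    (f : I -> X -> 'rV[R]_n -> \bar R) :
  (forall i, measN (f i)) -> measN (fun x v => \sum_(i <- s) f i x v)%E.
Proof.
move=> mf; elim: s => [|i s IH].
  rewrite (_ : (fun x v => _) = fun _ _ => 0%E); first exact: measN_cst.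
  by apply/funext => x; apply/funext => v; rewrite big_nil.
rewrite (_ : (fun x v => _) = fun x v => (f i x v + \sum_(i <- s) f i x v)%E).
  exact: measND.
by apply/funext => x; apply/funext => v; rewrite big_cons.
Qed.

Lemma intN_sum n (I : Type) (s : seq I) (f : I -> 'rV[R]_n -> \bar R) :
  (forall i v, 0 <= f i v)%E -> (forall i, measN (fun _ : unit => f i)) ->
  intN (fun v => \sum_(i <- s) f i v)%E = (\sum_(i <- s) intN (f i))%E.
Proof.
move=> f0 mf; elim: s => [|i s IH].
  rewrite big_nil -[RHS](intN0 n); congr intN.
  by apply/funext => v; rewrite big_nil.
rewrite big_cons -IH -intND //.
- by congr intN; apply/funext => v; rewrite big_cons.
- by move=> v; apply: sume_ge0.
- exact: measN_sum.
Qed.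

Lemma measN_exchange n d (X : measurableType d)
    (g : X * measurableTypeR R -> 'rV[R]_n.+1 -> \bar R) :
  measN g -> measN (fun (p : (X * measurableTypeR R) * measurableTypeR R) v =>
    g (p.1.1, p.2) (row_mx (p.1.2%:M : 'rV[R]_1) v)).
Proof.
apply: (@measN_comp n _ _ (X * measurableTypeR R * measurableTypeR R)%type
  (X * measurableTypeR R * measurableTypeR R)%type
  (fun p => ((p.1.1, p.2), p.1.2))
  (fun p v => g p.1 (row_mx (p.2%:M : 'rV[R]_1) v))).
apply/measurable_fun_pairP; split => /=.
  apply/measurable_fun_pairP; split; last exact: measurable_snd.
  exact: (measurableT_comp measurable_fst measurable_fst).
exact: (measurableT_comp measurable_snd measurable_fst).
Qed.

(** Tonelli between the extra variable [t] and all coordinates. The parameter space is general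
    because the induction stores in it the coordinates already peeled off; [measN_exchange] keeps
    [t] last. *)
Lemma intN_swap n d (X : measurableType d) (x : X)
    (g : X * measurableTypeR R -> 'rV[R]_n -> \bar R) :
  (forall p v, 0 <= g p v)%E -> measN g ->
  intN (fun v => \int[mu]_t g (x, t) v)%E = (\int[mu]_t intN (g (x, t)))%E.
Proof.
elim: n d X x g => [//|n IH] d X x g g0 mg /=.
have mh := measN_exchange mg.
under eq_integral do rewrite (IH _ (X * measurableTypeR R)%type (x, _) _ _ mh)//=.
apply: (fubini_tonelli (fun q : measurableTypeR R * measurableTypeR R =>
   intN (fun v => g (x, q.2) (row_mx (q.1%:M : 'rV_1) v)))).
- have /= m1 := measurable_intN (fun p v => g0 (p.1.1, p.2) _) mh.
  apply: (measurableT_comp (f := fun p : X * measurableTypeR R * measurableTypeR R =>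
    intN (fun v => g (p.1.1, p.2) (row_mx (p.1.2%:M : 'rV_1) v)))
    (g := fun q : measurableTypeR R * measurableTypeR R => ((x, q.1), q.2)) m1).
  apply/measurable_fun_pairP; split; last exact: measurable_snd.
  by apply/measurable_fun_pairP; split; [exact: measurable_cst|exact: measurable_fst].
- by move=> q; apply: intN_ge0 => v; exact: g0.
Qed.

End measN.

(** * Iterated Lebesgue measure of closed sets *)

Section rows.
Context {R : realType}.

Lemma row_mx_ord0 n (x : R) (v : 'rV[R]_n) :
  row_mx (x%:M : 'rV[R]_1) v ord0 ord0 = x.
Proof.
have -> : (ord0 : 'I_(1 + n)) = lshift n ord0 by apply/val_inj.
by rewrite row_mxEl mxE eqxx mulr1n.
Qed.

Lemma row_mx_lift0 n (x : R) (v : 'rV[R]_n) i :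
  row_mx (x%:M : 'rV[R]_1) v ord0 (lift ord0 i) = v ord0 i.
Proof.
have -> : (lift ord0 i : 'I_(1 + n)) = rshift 1 i by apply/val_inj.
by rewrite row_mxEr.
Qed.

Lemma rV_continuousP (T : topologicalType) n (f : T -> 'rV[R]_n) :
  (forall i, continuous (fun x => f x ord0 i)) -> continuous f.
Proof.
move=> fc x; apply/cvg_ballP => e e0.
have : \forall y \near x, forall i, ball (f x ord0 i) e (f y ord0 i).
  by apply: filter_forall => i; apply: (cvg_ball (fc i x)).
apply: filterS => y H; split => // i j.
by rewrite (ord1 i); exact: H.
Qed.

Lemma sum_continuous (T : topologicalType) (I : Type) (s : seq I) (f : I -> T -> R) :
  (forall i, continuous (f i)) -> continuous (fun x => \sum_(i <- s) f i x).
Proof.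
move=> fc; elim: s => [|i s IH] x.
  rewrite (_ : (fun x => _) = fun=> 0); first exact: cvg_cst.
  by apply/funext => y; rewrite big_nil.
rewrite (_ : (fun x => _) = fun x => f i x + \sum_(i <- s) f i x).
  by apply: cvgD; [exact: fc|exact: IH].
by apply/funext => y; rewrite big_cons.
Qed.

Lemma affine_continuous m n (M : 'M[R]_(m, n)) (b : 'rV[R]_n) :
  continuous (fun x : 'rV[R]_m => x *m M + b).
Proof.
apply: rV_continuousP => j.
rewrite (_ : (fun x => _) = fun x : 'rV[R]_m => \sum_k x ord0 k * M k j + b ord0 j).
  have sc : continuous (fun x : 'rV[R]_m => \sum_k x ord0 k * M k j).
    apply: sum_continuous => k y.
    have cc : continuous (fun x : 'rV[R]_m => x ord0 k) by exact: coord_continuous.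
    exact: (continuousM (cc y) (@cst_continuous _ _ (M k j) y)).
  by move=> x; exact: (continuousD (sc x) (@cst_continuous _ _ (b ord0 j) x)).
by apply/funext => x; rewrite !mxE.
Qed.

Lemma row_mx_continuous n (x : R) :
  continuous (fun v : 'rV[R]_n => row_mx (x%:M : 'rV[R]_1) v : 'rV[R]_n.+1).
Proof.
apply: rV_continuousP => j; case: (unliftP ord0 j) => [k ->|->].
  rewrite (_ : (fun v => _) = fun v : 'rV[R]_n => v ord0 k); first exact: coord_continuous.
  by apply/funext => v; rewrite row_mx_lift0.
rewrite (_ : (fun v => _) = fun v : 'rV[R]_n => x); first by move=> v; exact: cst_continuous.
by apply/funext => v; rewrite row_mx_ord0.
Qed.

Lemma closed_section n (A : set 'rV[R]_n.+1) (x : R) :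
  closed A -> closed [set v | A (row_mx (x%:M : 'rV[R]_1) v)].
Proof.
by move=> cA; apply: preimage_closed => // v _; exact: row_mx_continuous.
Qed.

Lemma closed_affine n (A : set 'rV[R]_n) (M : 'M[R]_n) b :
  closed A -> closed [set x | A (x *m M + b)].
Proof.
by move=> cA; apply: preimage_closed => // v _; exact: affine_continuous.
Qed.

End rows.

Fixpoint msetN (R : realType) (n : nat) :
    forall d (X : measurableType d), (X -> set 'rV[R]_n) -> Prop :=
  match n return forall d (X : measurableType d), (X -> set 'rV[R]_n) -> Prop with
  | 0 => fun d X A => measurable [set x : X | A x (0 : 'rV[R]_0)]
  | k.+1 => fun d X A =>
      msetN (fun (p : X * measurableTypeR R) =>
        [set v : 'rV[R]_k | A p.1 (row_mx (p.2%:M : 'rV[R]_1) v)])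
  end.
Arguments msetN {R n d X}.

Section msetN.
Context {R : realType}.

Lemma measN_indic n d (X : measurableType d) (A : X -> set 'rV[R]_n) :
  msetN A -> measN (fun x v => (\1_(A x) v)%:E).
Proof.
elim: n d X A => [|n IH] d X A /= mA; last exact: (IH _ _ _ mA).
apply/measurable_EFinP.
rewrite (_ : (fun x => _) = \1_[set x | A x 0]); first exact: measurable_indic.
by apply/funext => x; rewrite !indicE; congr (_ %:R).
Qed.

Lemma msetN_bigcup n d (X : measurableType d) (I : Type)
    (A : I -> X -> set 'rV[R]_n) : countable [set: I] ->
  (forall i, msetN (A i)) -> msetN (fun x => \bigcup_i A i x).
Proof.
move=> cI; elim: n d X A => [|n IH] d X A /= mA; last exact: IH.
rewrite (_ : mkset _ = \bigcup_i [set x | A i x 0]).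
  exact: countable_bigcupT_measurable.
by [].
Qed.

Lemma msetN_bigcap n d (X : measurableType d) (A : nat -> X -> set 'rV[R]_n) :
  (forall i, msetN (A i)) -> msetN (fun x => \bigcap_i A i x).
Proof.
elim: n d X A => [|n IH] d X A /= mA; last exact: IH.
rewrite (_ : mkset _ = \bigcap_i [set x | A i x 0]); first exact: bigcapT_measurable.
by [].
Qed.

(** The set [P] is there for the induction: each step turns the constraint on the first coordinate
    into one on the parameter. *)
Lemma msetN_box n d (X : measurableType d) (P : set X) (B : 'I_n -> set R) :
  measurable P -> (forall i, measurable (B i : set (measurableTypeR R))) ->
  msetN (fun x => [set v : 'rV[R]_n | P x /\ forall i, B i (v ord0 i)]).
Proof.
elim: n d X P B => [|n IH] d X P B mP mB /=.
  rewrite (_ : mkset _ = P) //; apply/seteqP; split => x /=; first by case.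
  by move=> Px; split => // -[].
rewrite (_ : (fun p => _) = (fun p : X * measurableTypeR R =>
    [set v : 'rV[R]_n | (P `*` B ord0) p /\ forall i, B (lift ord0 i) (v ord0 i)])).
  apply: (IH _ (X * measurableTypeR R)%type (P `*` B ord0) (fun i => B (lift ord0 i))) => //.
  exact: measurableX.
apply/funext => -[x t]; apply/seteqP; split => v /=.
- move=> [Px H]; split.
    by split => //; have := H ord0; rewrite row_mx_ord0.
  by move=> i; have := H (lift ord0 i); rewrite row_mx_lift0.
- move=> [[Px Bt] H]; split => // i.
  by case: (unliftP ord0 i) => [j ->|->]; rewrite ?row_mx_lift0 ?row_mx_ord0.
Qed.

(* A closed set is the intersection over k of the unions of the cubes of side
   1/(k+1) of a grid that meet it. *)
Lemma closed_msetN n (A : set 'rV[R]_n) : closed A -> msetN (fun _ : unit => A).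
Proof.
move=> cA.
pose I := {ffun 'I_n -> int}.
pose cube (k : nat) (z : I) : set 'rV[R]_n :=
  [set v | forall i, `[(z i)%:~R / k.+1%:R, ((z i)%:~R + 1) / k.+1%:R]%classic (v ord0 i)].
pose P k z := exists2 a, A a & cube k z a.
suff -> : A = \bigcap_k \bigcup_z [set v | P k z /\ cube k z v].
  apply: (msetN_bigcap (A := fun k _ => \bigcup_z [set v | P k z /\ cube k z v])) => k.
  apply: (msetN_bigcup (A := fun z _ => [set v | P k z /\ cube k z v])) => [|z].
    exact: countableP.
  apply: (msetN_box (X := unit) (P := [set _ | P k z])
    (B := fun i => `[(z i)%:~R / k.+1%:R, ((z i)%:~R + 1) / k.+1%:R]%classic)) => //.
apply/seteqP; split => v /=.
- move=> Av k _.
  have cv : cube k [ffun i => Num.floor (v ord0 i * k.+1%:R)] v.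
    move=> i /=; rewrite ffunE in_itv /=.
    have k0 : (0 : R) < k.+1%:R by rewrite ltr0n.
    rewrite ler_pdivrMr // ler_pdivlMr // floor_le_tmp.
    by have /ltW := floorD1_gt (v ord0 i * k.+1%:R); rewrite intrD => ->.
  by exists [ffun i => Num.floor (v ord0 i * k.+1%:R)] => //; split => //; exists v.
- move=> H; rewrite (closure_id A).1 // => U.
  move=> /nbhs_ballP[e /= e0 eU].
  (* The points [a] and [v] will share a cube of side [1/(k+1)], hence be within [e] of each other
     in the sup norm. *)
  have [k ke] : exists k : nat, k.+1%:R^-1 < e.
    have := near_infty_natSinv_lt (PosNum e0) => -[k _ /(_ k (leqnn _)) /= ?].
    by exists k.
  have [z _ [[a Aa ca] cv]] := H k Logic.I.
  exists a; split => //; apply: eU; split => // i j; rewrite (ord1 i).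
  apply: le_lt_trans ke.
  have := ca j; have := cv j => /=; rewrite !in_itv /= mulrDl mul1r.
  move=> /andP[a1 a2] /andP[b1 b2].
  move: (z j)%:~R (k.+1%:R^-1) a1 a2 b1 b2 => p q; move: (p * q) => w.
  by rewrite ler_norml; lra.
Qed.

Lemma closed_measN n (A : set 'rV[R]_n) : closed A ->
  measN (fun _ : unit => fun v => (\1_A v)%:E).
Proof. by move=> /closed_msetN /measN_indic. Qed.

Lemma measurable_lebN_section n (A : set 'rV[R]_n.+1) : closed A ->
  measurable_fun setT (fun x : measurableTypeR R =>
    lebN [set v : 'rV[R]_n | A (row_mx (x%:M : 'rV[R]_1) v)]).
Proof.
move=> cA.
rewrite (_ : (fun x => _) = fun x : measurableTypeR R =>
   intN (fun v => (\1_A (row_mx (x%:M : 'rV[R]_1) v))%:E)).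
  apply: (measurable_intN_row (f := fun v => (\1_A v)%:E)).
    by move=> v; rewrite lee_fin.
  exact: closed_measN.
by apply/funext => x; rewrite lebN_intN.
Qed.

Lemma lebN_ge0 n (A : set 'rV[R]_n) : (0 <= lebN A)%E.
Proof. by rewrite lebN_intN; apply: intN_ge0 => v; rewrite lee_fin. Qed.

Lemma lebN_box_le n (A : set 'rV[R]_n) (r : R) : 0 <= r -> closed A ->
  (forall v i, A v -> `|v ord0 i| <= r) -> (lebN A <= ((2 * r) ^+ n)%:E)%E.
Proof.
move=> r0; elim: n A => [|n IH] A cA Ar.
  by rewrite /= expr0 lee_fin indicE; case: (_ \in _).
have c0 : 0 <= (2 * r) ^+ n by rewrite exprn_ge0 // mulr_ge0.
have le1 : (lebN A <= \int[lebesgue_measure]_(x in `[(- r)%R, r]) ((2 * r) ^+ n)%:E)%E.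
  rewrite [leRHS]integral_mkcond; apply: ge0_le_integral => //.
  - by move=> x _; exact: lebN_ge0.
  - exact: measurable_lebN_section.
  - apply/(measurable_restrict _ _ _) => //; rewrite setTI; exact: measurable_cst.
  - move=> x _; rewrite patchE; case: ifPn => xr.
      apply: IH; first exact: closed_section.
      by move=> v i /= Av; have := Ar _ (lift ord0 i) Av; rewrite row_mx_lift0.
    rewrite -[X in (X <= _)%E]/(lebN [set v | A (row_mx (x%:M : 'rV_1) v)]).
    rewrite lebN_intN (_ : (fun v => _) = fun=> 0%E) ?intN0 //.
    apply/funext => v; rewrite indicE memNset //= => Av; have := Ar _ ord0 Av.
    move: xr; rewrite row_mx_ord0 notin_setE /= in_itv /= => h1 h2; apply: h1.
    by rewrite -ler_norml.
apply: (le_trans le1); rewrite integral_cst //= lebesgue_measure_itv /= lte_fin.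
case: ifPn => _; last by rewrite mule0 lee_fin exprn_ge0 // mulr_ge0.
by rewrite -EFinD -EFinM lee_fin exprS mulrC; have -> : r - - r = 2 * r by ring.
Qed.

Lemma compact_lebN_fin n (A : set 'rV[R]_n) : compact A -> lebN A \is a fin_num.
Proof.
move=> cA; have [M [Mr HM]] := compact_bounded cA.
have clA : closed A by apply: compact_closed cA; exact: norm_hausdorff.
rewrite ge0_fin_numE ?lebN_ge0 //.
apply: le_lt_trans (ltry ((2 * (`|M| + 1)) ^+ n)).
apply: lebN_box_le => // v i Av.
have /HM : M < `|M| + 1 by rewrite (le_lt_trans (ler_norm _)) // ltrDl.
move=> /(_ v Av); apply: le_trans.
have /mapP[j Hj ->] : `|v ord0 i| \in [seq `|v x.1 x.2| | x : 'I_1 * 'I_n].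
  by apply/mapP; exists (ord0, i) => //=; rewrite mem_enum.
by rewrite [leRHS]/Num.norm /= mx_normrE; apply/bigmax_geP; right => /=; exists j.
Qed.

End msetN.

(** * Affine change of variables *)

Section affine.
Context {R : realType}.
Local Notation mu := (@lebesgue_measure R).

Lemma lebesgue_measure_affine (a b : R) (A : set (measurableTypeR R)) : a != 0 ->
  measurable A -> (`|a|%:E * mu [set x | A (a * x + b)%R] = mu A)%E.
Proof.
move=> a0 mA.
pose phi := (fun x => a * x + b) : measurableTypeR R -> measurableTypeR R.
have mphi : measurable_fun setT phi.
  by apply: measurable_funD => //; exact: measurable_funM.
have an0 : 0 <= `|a| by [].
pose k := NngNum an0.
unshelve epose (nu := mscale k (pushforward mu phi) :
  {measure set (measurableTypeR R) -> \bar R}); first exact: mphi.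
have -> : (`|a|%:E * mu [set x | A (a * x + b)%R] = nu A)%E by [].
apply/esym/lebesgue_measure_unique => //= _ [[u v]] /= uv <-.
rewrite /nu /mscale /pushforward /=.
(* For negative [a] the reflection moves the closed end of the interval to the left. *)
rewrite [X in _ = (_ * mu X)%E](_ : _ = if 0 < a then `](u - b) / a, (v - b) / a]%classic
   else `[(v - b) / a, (u - b) / a[%classic); last first.
  apply/seteqP; case: ifPn => a1; split => x; rewrite /phi /= !in_itv /=.
  - by rewrite ltr_pdivrMr // ler_pdivlMr // mulrC ltrBlDr lerBrDr.
  - by rewrite ltr_pdivrMr // ler_pdivlMr // mulrC ltrBlDr lerBrDr.
  - have a2 : a < 0 by rewrite lt_neqAle a0 leNgt.
    by rewrite ler_ndivrMr // ltr_ndivlMr // mulrC ltrBlDr lerBrDr andbC.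
  - have a2 : a < 0 by rewrite lt_neqAle a0 leNgt.
    by rewrite ler_ndivrMr // ltr_ndivlMr // mulrC ltrBlDr lerBrDr andbC.
case: ifPn => a1; rewrite !lebesgue_measure_itv /= !lte_fin.
- rewrite ltr_pM2r ?invr_gt0 // ltrD2r; case: ifPn => _; last by rewrite mule0.
  rewrite -!EFinD -EFinM gtr0_norm //; congr EFin.
  by field.
- have a2 : a < 0 by rewrite lt_neqAle a0 leNgt.
  rewrite ltr_nM2r ?invr_lt0 // ltrD2r; case: ifPn => _; last by rewrite mule0.
  rewrite -!EFinD -EFinM ltr0_norm //; congr EFin.
  by field.
Qed.

Lemma ge0_integral_affine (a b : R) (f : R -> \bar R) : a != 0 ->
  measurable_fun setT (f : measurableTypeR R -> \bar R) -> (forall x, 0 <= f x)%E ->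
  (`|a|%:E * \int[mu]_x f (a * x + b)%R = \int[mu]_x f x)%E.
Proof.
move=> a0 mf f0.
pose phi := (fun x => a * x + b) : measurableTypeR R -> measurableTypeR R.
have mphi : measurable_fun setT phi.
  by apply: measurable_funD => //; exact: measurable_funM.
have an0 : 0 <= `|a| by [].
pose k := NngNum an0.
unshelve epose (nu := pushforward mu phi :
  {measure set (measurableTypeR R) -> \bar R}); first exact: mphi.
have E : (\int[nu]_x f x = \int[mu]_x f (a * x + b)%R)%E.
  rewrite /nu ge0_integral_pushforward //.
rewrite -E.
rewrite -[`|a|]/(k%:num) -ge0_integral_mscale //.
apply: eq_measure_integral => A mA _.
exact: lebesgue_measure_affine.
Qed.

(** All translations [b] are included because a block triangular map translates each section by an
    amount that depends on the first coordinate. *)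
Definition cvar n (M : 'M[R]_n) := forall b (A : set 'rV[R]_n), closed A ->
  (`|\det M|%:E * lebN [set x | A (x *m M + b)%R] = lebN A)%E.

Lemma cvarM n (M1 M2 : 'M[R]_n) : cvar M1 -> cvar M2 -> cvar (M1 *m M2).
Proof.
move=> h1 h2 b A cA.
rewrite det_mulmx normrM mulrC EFinM -muleA.
rewrite -[RHS](h2 b A cA); congr (_ * _)%E.
rewrite -(h1 0 _ (closed_affine (M := M2) (b := b) cA)); congr (_ * lebN _)%E.
by apply/funext => x /=; rewrite addr0 mulmxA.
Qed.

(** The first coordinate maps to [a x + b0] regardless of the others. Tonelli thus separates a
    substitution on the line from the map [D] on each section, translated by [x u + b1]. *)
Lemma cvar_ublock n (a : R) (u : 'rV[R]_n) (D : 'M[R]_n) : a != 0 -> cvar D ->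
  cvar (block_mx (a%:M : 'M[R]_1) u 0 D : 'M[R]_(n.+1)).
Proof.
move=> a0 hD b A cA.
rewrite (det_ublock (a%:M : 'M[R]_1)) det_scalar1 normrM.
set b0 := lsubmx (b : 'rV_(1 + n)) ord0 ord0; set b1 := rsubmx (b : 'rV_(1 + n)).
have rowE x (v : 'rV[R]_n) :
    row_mx (x%:M : 'rV_1) v *m block_mx (a%:M : 'M[R]_1) u 0 D + (b : 'rV_(1 + n)) =
    row_mx ((a * x + b0)%:M : 'rV_1) (v *m D + (x *: u + b1)).
  rewrite -[b in LHS](@hsubmxK _ 1 1 n) mul_row_block add_row_mx mulmx0 addr0.
  congr row_mx.
    rewrite [LHS]mx11_scalar; congr _%:M.
    by rewrite -scalar_mxM mxE mxE eqxx mulr1n mulrC.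
  by rewrite mul_scalar_mx addrAC addrA addrC addrA.
rewrite [lebN A]/=.
rewrite -(ge0_integral_affine b0 a0
  (f := fun x => lebN [set v | A (row_mx (x%:M : 'rV_1) v)])); last 2 first.
- exact: measurable_lebN_section.
- by move=> x; exact: lebN_ge0.
rewrite EFinM -muleA; congr (_ * _)%E.
rewrite /= -ge0_integralZl //; last 2 first.
- apply: (measurable_lebN_section (A := [set x : 'rV_n.+1 |
    A (x *m (block_mx (a%:M : 'M[R]_1) u 0 D : 'M[R]_(n.+1)) + b)])).
  exact: closed_affine.
- by move=> x _; exact: lebN_ge0.
apply: eq_integral => x _.
rewrite -(hD (x *: u + b1) _ (closed_section (x := a * x + b0) cA)).
congr (_ * lebN _)%E; apply/funext => v /=.
by rewrite rowE.
Qed.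

Lemma cvar0 (M : 'M[R]_0) : cvar M.
Proof.
move=> b A _; rewrite det_mx00 normr1 mul1e /= !indicE; congr (_%:E).
congr (_ %:R); congr nat_of_bool.
by apply/idP/idP => /set_mem h; apply/mem_set; move: h; rewrite /= [_ + b](thinmx0).
Qed.

Lemma cvar1 n : cvar (1%:M : 'M[R]_n).
Proof.
elim: n => [|n IH]; first exact: cvar0.
have := cvar_ublock (0 : 'rV[R]_n) (oner_neq0 _) IH.
by rewrite -(scalar_mx_block 1 n).
Qed.

Lemma lebN_translate n (b : 'rV[R]_n) (A : set 'rV[R]_n) : closed A ->
  lebN [set x | A (x + b)] = lebN A.
Proof.
move=> cA; rewrite -(cvar1 b cA) det1 normr1 mul1e.
by congr lebN; apply/funext => x /=; rewrite mulmx1.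
Qed.

Lemma closed_translate n (b : 'rV[R]_n) (A : set 'rV[R]_n) : closed A ->
  closed [set x | A (x + b)].
Proof.
move=> cA; rewrite (_ : mkset _ = [set x | A (x *m 1%:M + b)]).
  exact: closed_affine.
by apply/funext => x /=; rewrite mulmx1.
Qed.

Lemma closed_row_mxl n (A : set 'rV[R]_n.+1) (v : 'rV[R]_n) : closed A ->
  closed [set t : R | A (row_mx (t%:M : 'rV_1) v)].
Proof.
move=> cA; apply: (preimage_closed (D := A)
  (f := fun t : R => row_mx (t%:M : 'rV_1) v : 'rV_n.+1)) => // t _.
suff : continuous (fun t : R => row_mx (t%:M : 'rV_1) v : 'rV_n.+1) by apply.
apply: rV_continuousP => j; case: (unliftP ord0 j) => [k ->|->].
  rewrite (_ : (fun t => _) = fun=> v ord0 k); first by move=> y; exact: cst_continuous.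
  by apply/funext => y; rewrite row_mx_lift0.
rewrite (_ : (fun t => _) = id); first by move=> y; exact: cvg_id.
by apply/funext => y; rewrite row_mx_ord0.
Qed.

Lemma lebN_swap n (B : set 'rV[R]_n.+1) : closed B -> lebN B =
  intN (fun v : 'rV[R]_n => \int[mu]_t (\1_B (row_mx (t%:M : 'rV_1) v))%:E)%E.
Proof.
move=> cB; rewrite lebN_intN /=.
have mB : measN (fun (p : unit * measurableTypeR R) (v : 'rV_n) =>
  (\1_B (row_mx (p.2%:M : 'rV_1) v))%:E) := closed_measN cB.
by rewrite (intN_swap tt _ mB).
Qed.

(** The first coordinate is shifted by [v c], which depends on the others. Once it is integrated
    innermost, the shift is a translation of the line. *)
Lemma cvar_lshear n (c : 'cV[R]_n) :
  cvar (block_mx (1%:M : 'M[R]_1) 0 c 1%:M : 'M[R]_(n.+1)).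
Proof.
move=> b A cA.
rewrite (det_lblock (1%:M : 'M[R]_1)) !det1 mul1r normr1 mul1e.
rewrite -[RHS](lebN_translate b) //.
have cA' := closed_translate (b := b) cA.
set A' := [set x | A (x + b)] in cA' *.
rewrite (lebN_swap cA') lebN_swap; last exact: closed_affine.
congr intN; apply/funext => v.
rewrite -[RHS](ge0_integral_affine ((v *m c) ord0 ord0) (oner_neq0 _)); last 2 first.
- apply/measurable_EFinP.
  rewrite (_ : (fun t => _) = \1_[set t : R | A' (row_mx (t%:M : 'rV_1) v)]).
    by apply: measurable_indic; apply: closed_measurable; exact: closed_row_mxl.
  by apply/funext => t; rewrite !indicE; congr (_ %:R).
- by move=> x; rewrite lee_fin.
rewrite normr1 mul1e; apply: eq_integral => t _.
congr (_%:E); rewrite !indicE; congr (_ %:R); congr nat_of_bool.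
have E : row_mx (t%:M : 'rV_1) v *m block_mx (1%:M : 'M[R]_1) 0 c 1%:M =
  row_mx ((1 * t + (v *m c) ord0 ord0)%:M : 'rV_1) v.
  rewrite mul_row_block !mulmx1 mulmx0 add0r; congr row_mx.
  rewrite [LHS]mx11_scalar; congr _%:M.
  by rewrite mxE mxE eqxx mulr1n mul1r.
by apply/idP/idP => /set_mem h; apply/mem_set; move: h; rewrite /A' /= E.
Qed.

(** Block elimination: a lower shear times an upper triangular matrix whose lower block is the Schur
    complement of [a]. *)
Lemma cvar_pivot n (a : R) (u : 'rV[R]_n) (c : 'cV[R]_n) (D : 'M[R]_n) :
  (forall M : 'M[R]_n, M \in unitmx -> cvar M) -> a != 0 ->
  (block_mx (a%:M : 'M[R]_1) u c D : 'M[R]_n.+1) \in unitmx ->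
  cvar (block_mx (a%:M : 'M[R]_1) u c D : 'M[R]_n.+1).
Proof.
move=> IH a0.
have -> : block_mx (a%:M : 'M[R]_1) u c D =
  block_mx (1%:M : 'M[R]_1) 0 (a^-1 *: c) 1%:M *m
  block_mx (a%:M : 'M[R]_1) u 0 (D - a^-1 *: c *m u).
  rewrite mulmx_block !mul1mx !mul0mx !addr0 mul_mx_scalar scalerA divff // scale1r.
  by rewrite addrC subrK.
rewrite unitmx_mul => /andP[_].
rewrite unitmxE (det_ublock (a%:M : 'M[R]_1)) unitrM => /andP[_ uD].
apply: (@cvarM n.+1); first exact: cvar_lshear.
by apply: cvar_ublock => //; apply: IH; rewrite unitmxE.
Qed.

Lemma unitmx_cvar n (M : 'M[R]_n) : M \in unitmx -> cvar M.
Proof.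
elim: n M => [|n IH] M uM; first exact: cvar0.
have ME : M = block_mx ((ulsubmx (M : 'M[R]_(1 + n)) ord0 ord0)%:M : 'M[R]_1)
    (ursubmx (M : 'M[R]_(1 + n))) (dlsubmx (M : 'M[R]_(1 + n))) (drsubmx (M : 'M[R]_(1 + n))).
  by rewrite -mx11_scalar submxK.
move: (ulsubmx (M : 'M[R]_(1 + n)) ord0 ord0) (ursubmx (M : 'M[R]_(1 + n)))
  (dlsubmx (M : 'M[R]_(1 + n))) (drsubmx (M : 'M[R]_(1 + n))) ME => a u c D ME.
rewrite {M}ME in uM *.
have [a0|a0] := eqVneq a 0; last exact: cvar_pivot.
have [c0|[i ci]] : c = 0 \/ exists i, c i ord0 != 0.
  case: (pselect (exists i, c i ord0 != 0)) => [?|h]; first by right.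
  left; apply/matrixP => i j; rewrite mxE (ord1 j); apply/eqP/negPn/negP => ci.
  by apply: h; exists i.
  exfalso; move: uM; rewrite unitmxE c0 a0 (det_ublock (0%:M : 'M[R]_1)) det_scalar1 mul0r.
  by rewrite unitr0.
(* The corner is zero: adding row [i] of the lower part to the first row brings the nonzero entry
   [c i] into it. *)
pose r : 'rV[R]_n := delta_mx ord0 i.
pose M' := block_mx ((c i ord0)%:M : 'M[R]_1) (u + r *m D) c D.
have E : block_mx (a%:M : 'M[R]_1) u c D = block_mx (1%:M : 'M[R]_1) (- r) 0 1%:M *m M'.
  rewrite /M' (mulmx_block (1%:M : 'M[R]_1)) !mul1mx !mul0mx !add0r !mulNmx addrK.
  congr block_mx; rewrite a0; apply/matrixP => k l; rewrite !ord1.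
  by rewrite /r -rowE !mxE subrr mul0rn.
rewrite E; apply: (@cvarM n.+1).
  by apply: cvar_ublock; [exact: oner_neq0|exact: cvar1].
apply: cvar_pivot => //.
by move: uM; rewrite E unitmx_mul => /andP[].
Qed.

End affine.

(** * Prisms over flat sets *)

Section dotp.
Context {R : realType} {N : nat}.
Implicit Types x y z : 'rV[R]_N.

Lemma dotpE x y : dotp x y = (x *m y^T) ord0 ord0.
Proof. by rewrite mxE; apply: eq_bigr => i _; rewrite mxE. Qed.

Lemma dotpC x y : dotp x y = dotp y x.
Proof. by apply: eq_bigr => i _; rewrite mulrC. Qed.

Lemma dotpDl x y z : dotp (x + y) z = dotp x z + dotp y z.
Proof. by rewrite !dotpE mulmxDl mxE. Qed.

Lemma dotpZl (a : R) x y : dotp (a *: x) y = a * dotp x y.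
Proof. by rewrite !dotpE -scalemxAl mxE. Qed.

Lemma dotpNl x y : dotp (- x) y = - dotp x y.
Proof. by rewrite !dotpE mulNmx mxE. Qed.

Lemma dotpBl x y z : dotp (x - y) z = dotp x z - dotp y z.
Proof. by rewrite dotpDl dotpNl. Qed.

Lemma dotpDr x y z : dotp x (y + z) = dotp x y + dotp x z.
Proof. by rewrite dotpC dotpDl !(dotpC x). Qed.

Lemma dotpZr (a : R) x y : dotp x (a *: y) = a * dotp x y.
Proof. by rewrite dotpC dotpZl dotpC. Qed.

Lemma dotpNr x y : dotp x (- y) = - dotp x y.
Proof. by rewrite dotpC dotpNl dotpC. Qed.

Lemma dotpBr x y z : dotp x (y - z) = dotp x y - dotp x z.
Proof. by rewrite dotpDr dotpNr. Qed.

Lemma dotp_ge0 x : 0 <= dotp x x.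
Proof. by apply: sumr_ge0 => i _; rewrite -expr2 sqr_ge0. Qed.

End dotp.

(** Two block triangular matrices multiplied in both orders give the two sides, and the determinant
    of a product does not depend on the order. *)
Lemma det_rank1_update (F : comUnitRingType) n (c : 'cV[F]_n) (r : 'rV[F]_n) :
  \det (1%:M + c *m r) = 1 + (r *m c) ord0 ord0.
Proof.
have E1 : block_mx (1%:M : 'M[F]_1) 0 c 1%:M *m block_mx (1%:M : 'M[F]_1) r (- c) 1%:M =
    block_mx (1%:M : 'M[F]_1) r 0 (1%:M + c *m r).
  rewrite mulmx_block !mul1mx !mul0mx !mulmx1 !addr0 subrr; congr block_mx.
  by rewrite addrC.
have E2 : block_mx (1%:M : 'M[F]_1) r (- c) 1%:M *m block_mx (1%:M : 'M[F]_1) 0 c 1%:M =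
    block_mx (1%:M + r *m c : 'M[F]_1) r 0 1%:M.
  by rewrite mulmx_block !mul1mx !mulmx1 !mulmx0 !add0r addNr.
have := congr1 (@determinant _ _) E1; have := congr1 (@determinant _ _) E2.
rewrite !det_mulmx !det_ublock !det_lblock !det1 !mul1r !mulr1 => -> <-.
by rewrite det_mx11 !mxE eqxx.
Qed.

(** [flat_area n S] is [lebN (prism S n)] by conversion; the direction is left free so that a facet
    can be swept along any vector. *)
Definition prism (R : realType) (N : nat) (S : set 'rV[R]_N) (v : 'rV[R]_N) :=
  [set y | exists2 x, S x & exists2 a : R, 0 <= a <= 1 & y = x + a *: v].

Section prism.
Context {R : realType} {N : nat}.
Implicit Types (S : set 'rV[R]_N) (n v w x : 'rV[R]_N).

Lemma compact_prism S v : compact S -> compact (prism S v).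
Proof.
move=> cS.
pose f (p : 'rV[R]_N * R) := p.1 + p.2 *: v.
have -> : prism S v = f @` (S `*` `[0, 1]%classic).
  apply/seteqP; split => y.
  - by move=> [x Sx [a a01 ->]]; exists (x, a) => //; split => //=; rewrite in_itv.
  - by move=> [[x a] [Sx /=]]; rewrite in_itv /= => a01 <-; exists x => //; exists a.
apply: continuous_compact.
  apply: continuous_subspaceT => -[x a].
  apply: (@cvgD _ _ _ (nbhs (x, a)) _ fst (fun p => p.2 *: v)).
    exact: cvg_fst.
  by apply: cvgZr_tmp; exact: cvg_snd.
by apply: compact_setX => //; exact: segment_compact.
Qed.

Lemma compact_rV_closed S : compact S -> closed S.
Proof. by apply: compact_closed; exact: norm_hausdorff. Qed.

(* The map x |-> x + (x.n - b) w fixes the hyperplane x.n = b and sends n to n + w. *)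
Lemma lebN_transvection n w (b : R) (A : set 'rV[R]_N) : 1 + dotp w n != 0 -> closed A ->
  (`|1 + dotp w n|%:E * lebN [set x | A (x + (dotp x n - b) *: w)%R] = lebN A)%E.
Proof.
move=> d0 cA.
have dE : \det (1%:M + n^T *m w) = 1 + dotp w n by rewrite det_rank1_update dotpE.
have uM : 1%:M + n^T *m w \in unitmx by rewrite unitmxE dE unitfE.
rewrite -(unitmx_cvar uM (- b *: w) cA) dE; congr (_ * lebN _)%E.
apply/funext => x /=; congr A.
rewrite mulmxDr mulmx1 mulmxA [x *m n^T]mx11_scalar -dotpE mul_scalar_mx.
by rewrite scalerBl scaleNr addrA.
Qed.

(** The dilation by 2 normal to the hyperplane fixes [S], so twice the finite measure of [S] equals
    itself. *)
Lemma lebN_flat S n (b : R) : dotp n n = 1 -> compact S ->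
  (forall x, S x -> dotp x n = b) -> lebN S = 0%E.
Proof.
move=> n1 cS Sb.
have := lebN_transvection (n := n) (w := n) b _ (compact_rV_closed cS).
rewrite n1 (_ : [set x | _] = S); last first.
  apply/seteqP; split => x /=; last by move=> Sx; rewrite Sb // subrr scale0r addr0.
  move=> Sx; have := Sb _ Sx; rewrite dotpDl dotpZl n1 mulr1 => h.
  have h0 : dotp x n - b = 0 by lra.
  by move: Sx; rewrite h0 scale0r addr0.
have := compact_lebN_fin cS; case: (lebN S) => // r _.
rewrite (_ : 1 + 1 = 2%:R :> R) // pnatr_eq0 => /(_ isT).
rewrite normr_nat -EFinM => -[] h; congr EFin; lra.
Qed.

(** The transvection that fixes the hyperplane and sends [n] to [v] carries one prism onto the other
    and has determinant [n.v]. If [n.v = 0], the prism in direction [v] is itself flat. *)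
Lemma lebN_prism S n v (b : R) : dotp n n = 1 -> compact S ->
  (forall x, S x -> dotp x n = b) ->
  lebN (prism S v) = (`|dotp n v|%:E * flat_area n S)%E.
Proof.
move=> n1 cS Sb.
have [nv0|nv0] := eqVneq (dotp n v) 0.
  rewrite nv0 normr0 mul0e; apply: (lebN_flat (b := b) n1 (compact_prism (v := v) cS)).
  by move=> y [x Sx [a _ ->]]; rewrite dotpDl dotpZl (dotpC v) nv0 mulr0 addr0 Sb.
have dw : 1 + dotp (v - n) n = dotp n v by rewrite dotpBl n1 (dotpC v) addrC subrK.
have cP := compact_rV_closed (compact_prism (v := v) cS).
rewrite -(lebN_transvection (n := n) (w := v - n) b _ cP) dw //.
congr (_ * lebN _)%E; apply/seteqP; split => z /=.
- move=> [x Sx [a a01 E]]; exists x => //; exists a => //.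
  have h : dotp z n + (dotp z n - b) * (dotp v n - 1) = b + a * dotp v n.
    have : dotp (z + (dotp z n - b) *: (v - n)) n = dotp (x + a *: v) n by rewrite E.
    by rewrite !dotpDl !dotpZl dotpDl dotpNl n1 (Sb x).
  have ha : dotp z n - b = a.
    by rewrite dotpC in nv0; apply: (mulIf nv0); lra.
  move: E; rewrite ha scalerBr => /matrixP E.
  by apply/matrixP => i j; have := E i j; rewrite !mxE; lra.
- move=> [x Sx [a a01 ->]]; exists x => //; exists a => //.
  rewrite dotpDl dotpZl n1 Sb // mulr1 (addrC b) addrK scalerBr.
  by apply/matrixP => i j; rewrite !mxE; ring.
Qed.

End prism.

(** * Gauss formula on the elements of a mesh *)

Section ae.
Context {R : realType}.

Lemma measNZl n d (X : measurableType d) (k : R) (f : X -> 'rV[R]_n -> \bar R) :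
  measN f -> measN (fun x v => k%:E * f x v)%E.
Proof.
elim: n d X f => [|n IH] d X f /= mf; last exact: IH.
exact: measurable_funeM.
Qed.

Lemma intNZl n (k : R) (f : 'rV[R]_n -> \bar R) : 0 <= k ->
  (forall v, 0 <= f v)%E -> measN (fun _ : unit => f) ->
  intN (fun v => k%:E * f v)%E = (k%:E * intN f)%E.
Proof.
move=> k0; elim: n f => [//|n IH] f f0 mf /=.
rewrite -ge0_integralZl //.
- by apply: eq_integral => x _; rewrite IH //; exact: measN_section.
- exact: measurable_intN_row.
- by move=> x _; apply: intN_ge0.
Qed.

(** With [h] equal to [C] times the sum of the indicators of the [Z j], the function [g + h]
    dominates [f] everywhere and has the same integral as [g]; the bound [C] pays for the
    exceptional points. *)
Lemma intN_ae_le n (J : finType) (Z : J -> set 'rV[R]_n) (f g : 'rV[R]_n -> \bar R) (C : R) :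
  0 <= C -> (forall j, closed (Z j)) -> (forall j, lebN (Z j) = 0%E) ->
  (forall v, 0 <= f v <= C%:E)%E -> (forall v, 0 <= g v)%E ->
  measN (fun _ : unit => f) -> measN (fun _ : unit => g) ->
  (forall v, (forall j, ~ Z j v) -> f v = g v) -> (intN f <= intN g)%E.
Proof.
move=> C0 cZ Z0 fC g0 mf mg fg.
pose h v := (\sum_j C%:E * (\1_(Z j) v)%:E)%E.
have mZ j : measN (fun _ : unit => fun v => (C%:E * (\1_(Z j) v)%:E)%E).
  by apply: measNZl; exact: closed_measN.
have pZ j v : (0 <= C%:E * (\1_(Z j) v)%:E)%E by rewrite mule_ge0 ?lee_fin.
have mh : measN (fun _ : unit => h) by apply: measN_sum.
have h0 v : (0 <= h v)%E by apply: sume_ge0.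
have h_0 : intN h = 0%E.
  rewrite /h intN_sum // big1 // => j _.
  rewrite intNZl //; first by rewrite -lebN_intN Z0 mule0.
  exact: closed_measN.
rewrite -[leRHS]adde0 -h_0 -intND //; apply: le_intN => //.
- by move=> v; have /andP[] := fC v.
- move=> v; case: (pselect (exists j, Z j v)) => [[j Zj]|nZ].
    have /andP[_ /le_trans] := fC v; apply.
    rewrite -[leLHS]add0e; apply: leeD => //.
    rewrite /h (bigD1 j) //= indicE mem_set // mule1.
    by rewrite -[leLHS]adde0; apply: leeD => //; apply: sume_ge0.
  rewrite fg; first by rewrite -[leLHS]adde0; apply: leeD.
  by move=> j Zj; apply: nZ; exists j.
- exact: measND.
Qed.

(** The derivative vanishes inside, so connectedness of the interval enters through the mean value
    theorem. *)
Lemma locally_constant01 (G : R -> R) :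
  (forall t : R, 0 <= t <= 1 -> \forall s \near t, G s = G t) -> G 0 = G 1.
Proof.
move=> lc.
have dG (t : R) : t \in `]0, 1[ -> is_derive t 1 G 0.
  rewrite in_itv /= => /andP[t0 t1].
  apply: (@near_eq_is_derive _ _ _ (cst (G t))).
  by have := lc t; rewrite !ltW // => /(_ isT); apply: filterS => s ->.
have cG : {within `[0, 1], continuous G}.
  apply: continuous_in_subspaceT => t; rewrite inE /= in_itv /= => /lc.
  move=> H; apply/cvgrPdist_lt => e e0.
  by move: H; apply: filterS => s ->; rewrite subrr normr0.
have [c _] := MVT_segment (df := fun=> 0) ler01 dG cG.
by rewrite mul0r => /eqP; rewrite subr_eq0 => /eqP.
Qed.

Context {N : nat}.
Implicit Types (K : set 'rV[R]_N) (p q x v : 'rV[R]_N).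

Lemma line_continuous p v : continuous (fun t : R => p + t *: v).
Proof.
move=> t; apply: cvgD; first exact: cst_continuous.
by apply: cvgZr_tmp; exact: cvg_id.
Qed.

Lemma near_indic_line K p v (t : R) : closed K -> ~ (K `\` K°) (p + t *: v) ->
  \forall s \near t, \1_K (p + s *: v) = \1_K (p + t *: v) :> R.
Proof.
move=> cK nb; case: (pselect (K (p + t *: v))) => Kt.
  have Ki : K° (p + t *: v) by apply: contrapT => h; apply: nb.
  have : \forall s \near t, K (p + s *: v) by apply: (line_continuous Ki).
  by apply: filterS => s Ks; rewrite !indicE !mem_set.
have oK : nbhs (p + t *: v) (~` K) by apply: open_nbhs_nbhs; split => //; exact: closed_openC.
have : \forall s \near t, (~` K) (p + s *: v) by apply: (line_continuous oK).
by apply: filterS => s Ks; rewrite !indicE !memNset.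
Qed.

Lemma segment_avoid_boundary K p q : closed K ->
  (forall t, 0 <= t <= 1 -> ~ (K `\` K°) (p + t *: (q - p))) -> K p -> K q.
Proof.
move=> cK nb Kp.
have := @locally_constant01 (fun t => \1_K (p + t *: (q - p)))
  (fun t t01 => near_indic_line cK (nb t t01)).
rewrite scale0r addr0 scale1r addrC subrK !indicE mem_set //.
by case: (boolP (q \in K)) => [/set_mem//|_ /eqP]; rewrite oner_eq0.
Qed.

Lemma ball_segment x p q (r t : R) : ball x r p -> ball x r q -> 0 <= t <= 1 ->
  ball x r (p + t *: (q - p)).
Proof.
rewrite -!ball_normE /= => hp hq /andP[t0 t1].
have -> : x - (p + t *: (q - p)) = (1 - t) *: (x - p) + t *: (x - q).
  rewrite !scalerBr !scalerBl !scale1r; apply/matrixP => i j; rewrite !mxE; ring.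
apply: (le_lt_trans (ler_normD _ _)); rewrite !normrZ (ger0_norm t0) ger0_norm ?subr_ge0 //.
have [->|tn] := eqVneq t 0; first by rewrite subr0 mul1r mul0r addr0.
have tp : 0 < t by rewrite lt0r tn.
have h1 : t * `|x - q| < t * r by rewrite ltr_pM2l.
have h2 : (1 - t) * `|x - p| <= (1 - t) * r by rewrite ler_wpM2l ?subr_ge0 // ltW.
lra.
Qed.

End ae.

(** * Crossings of the facets of a polyhedron by a segment *)

Section polyhedron.
Context {R : realType} {N : nat} {I : finType}.
Variables (K : set 'rV[R]_N) (F : I -> set 'rV[R]_N) (nu : I -> 'rV[R]_N)
  (b : I -> R) (P : pred I) (v : 'rV[R]_N).
Hypothesis cK : compact K.
Hypothesis boundaryK : K `\` K° = \bigcup_(f in [set f | P f]) F f.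
Hypothesis cF : forall f, compact (F f).
Hypothesis nu1 : forall f, dotp (nu f) (nu f) = 1.
Hypothesis flatF : forall f x, F f x -> dotp x (nu f) = b f.
Hypothesis overlap : forall f g, f != g -> flat_area (nu f) (F f `&` F g) = 0%E.
Hypothesis sides : forall f x, P f -> F f x -> (forall g, g != f -> ~ F g x) ->
  \forall d \near 0^'+, K° (x - d *: nu f) /\ ~ K (x + d *: nu f).

Let clK : closed K := compact_rV_closed cK.

(** [sides] only informs about the normal line through [x]. In a ball that avoids the other facets,
    the boundary of [K] lies in the hyperplane of [f]; each open half ball is convex and free of
    boundary, so membership in [K] is constant on it and is read off on the normal line. *)
Lemma facet_sides f x : P f -> F f x -> (forall g, g != f -> ~ F g x) ->
  exists2 r : R, 0 < r & forall z, ball x r z ->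
    (dotp (z - x) (nu f) < 0 -> K z) /\ (0 < dotp (z - x) (nu f) -> ~ K z).
Proof.
move=> Pf Fx core.
have [r r0 Hr] : exists2 r : R, 0 < r & forall z, ball x r z -> forall g, g != f -> ~ F g z.
  have : \forall z \near x, forall g, g != f -> ~ F g z.
    apply: (@filter_forall _ _ (fun g z => g != f -> ~ F g z) (nbhs x) (nbhs_filter x)) => g.
    have [->|gf] := eqVneq g f; first exact: nearW.
    have : nbhs x (~` F g).
      apply: open_nbhs_nbhs; split; last exact: core.
      by apply: closed_openC; exact: compact_rV_closed.
    by apply: filterS.
  by move=> /nbhs_ballP[r r0 Hr]; exists r.
exists r => // z xz.
have avoid p q : ball x r p -> ball x r q ->
    (forall t, 0 <= t <= 1 -> dotp (p + t *: (q - p) - x) (nu f) != 0) -> K p -> K q.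
  move=> bp bq nz; apply: segment_avoid_boundary => // t t01.
  rewrite boundaryK => -[g Pg Fg].
  have [E|gf] := eqVneq g f; last first.
    exact: (Hr _ (ball_segment bp bq t01) g gf).
  move: (nz t t01); rewrite E in Fg.
  by rewrite dotpBl (flatF Fg) (flatF Fx) subrr eqxx.
have [d [d0 [Kd nKd] [bd1 bd2]]] : exists d : R, [/\ 0 < d,
    K° (x - d *: nu f) /\ ~ K (x + d *: nu f) &
    ball x r (x - d *: nu f) /\ ball x r (x + d *: nu f)].
  have h1 : \forall d \near (0 : R)^'+, ball x r (x - d *: nu f).
    have E : nbhs (x + (0 : R) *: (- nu f)) (ball x r).
      by rewrite scale0r addr0; exact: nbhsx_ballx.
    apply: cvg_within; move: (line_continuous E).
    by apply: (@filterS _ (nbhs (0 : R))) => d /=; rewrite scalerN.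
  have h2 : \forall d \near (0 : R)^'+, ball x r (x + d *: nu f).
    have E : nbhs (x + (0 : R) *: nu f) (ball x r).
      by rewrite scale0r addr0; exact: nbhsx_ballx.
    by apply: cvg_within; exact: (line_continuous E).
  have h0 : \forall d \near (0 : R)^'+, 0 < d by exact: nbhs_right_gt.
  have H : \forall d \near (0 : R)^'+, [/\ 0 < d, K° (x - d *: nu f) /\ ~ K (x + d *: nu f)
      & ball x r (x - d *: nu f) /\ ball x r (x + d *: nu f)].
    near=> d; split; first by near: d; exact: h0.
      by near: d; exact: (sides Pf Fx core).
    by split; near: d; [exact: h1|exact: h2].
  have [d [? ? ?]] := @filter_ex _ _ (at_right_proper_filter (0 : R)) _ H.
  by exists d.
(* Both segments stay in an open half ball: the normal components of their points are convex
   combinations of two numbers of the same sign. *)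
split => hz.
- apply: (avoid (x - d *: nu f)) => //; last exact: interior_subset Kd.
  move=> t /andP[t0 t1]; apply/eqP => h.
  have : (1 - t) * - d + t * dotp (z - x) (nu f) = 0.
    rewrite -h !dotpBl !dotpDl dotpZl !dotpBl dotpNl !dotpZl nu1; ring.
  nra.
- move=> Kz; apply: nKd; apply: (avoid z) => //.
  move=> t /andP[t0 t1]; apply/eqP => h.
  have : (1 - t) * dotp (z - x) (nu f) + t * d = 0.
    rewrite -h !dotpBl !dotpDl dotpZl !dotpBl !dotpDl !dotpZl nu1; ring.
  nra.
Unshelve. all: by end_near. Qed.

(** Reversing the parameter, [t = 1 - a], turns membership in a prism into a hit of [S] by the
    segment from [y - v] to [y]. *)
Lemma prismP (S : set 'rV[R]_N) y :
  prism S v y <-> exists2 t, 0 <= t <= 1 & S (y - v + t *: v).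
Proof.
have E (t : R) x : y = x + (1 - t) *: v <-> x = y - v + t *: v.
  by split=> ->; rewrite scalerBl scale1r; apply/matrixP => i j; rewrite !mxE; ring.
split.
- move=> [x Sx [a /andP[a0 a1] yE]]; exists (1 - a); first by apply/andP; split; lra.
  suff <- : x = y - v + (1 - a) *: v by [].
  by apply/E; rewrite opprB addrCA subrr addr0.
- move=> [t /andP[t0 t1] St]; exists (y - v + t *: v) => //.
  by exists (1 - t); [apply/andP; split; lra|apply/E].
Qed.

(** The points [y] whose segment from [y - v] to [y] passes through a common point of two facets,
    meets a facet parallel to it, ends on a facet, or starts on one. *)
Definition bad_set (j : (I * I) + (I + (I + I))) : set 'rV[R]_N :=
  match j with
  | inl (f, g) => if f != g then prism (F f `&` F g) v else set0
  | inr (inl f) => if dotp (nu f) v == 0 then prism (F f) v else set0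
  | inr (inr (inl f)) => F f
  | inr (inr (inr f)) => [set y | F f (y - v)]
  end.

Lemma closed_bad_set j : closed (bad_set j).
Proof.
case: j => [[f g]|[f|[f|f]]] /=.
- case: ifP => _; last exact: closed0.
  apply: compact_rV_closed; apply: compact_prism.
  by apply: compact_closedI => //; exact: compact_rV_closed.
- by case: ifP => _; [apply: compact_rV_closed; exact: compact_prism|exact: closed0].
- exact: compact_rV_closed.
- by apply: closed_translate; exact: compact_rV_closed.
Qed.

Lemma lebN_bad_set j : lebN (bad_set j) = 0%E.
Proof.
have l0 : lebN (set0 : set 'rV[R]_N) = 0%E.
  rewrite lebN_intN -[RHS](@intN0 R N); congr intN.
  by apply/funext => w; rewrite indic0.
case: j => [[f g]|[f|[f|f]]] /=.
- case: ifPn => // fg; rewrite (lebN_prism (b := b f) _ (nu1 f)) ?overlap ?mule0 //.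
    by apply: compact_closedI => //; exact: compact_rV_closed.
  by move=> x [/flatF].
- case: ifPn => // /eqP f0; rewrite (lebN_prism (b := b f) _ (nu1 f)) //.
    by rewrite f0 normr0 mul0e.
  by move=> x /flatF.
- by apply: (lebN_flat (b := b f) (nu1 f)) => // x /flatF.
- rewrite lebN_translate; last exact: compact_rV_closed.
  by apply: (lebN_flat (b := b f) (nu1 f)) => // x /flatF.
Qed.

Let c y (t : R) := y - v + t *: v.
(** The time at which the line [c y] meets the hyperplane of [f]. It is only used when the segment
    hits [f], and then the denominator is nonzero unless [y] is bad. *)
Let tau y f := (b f - dotp (y - v) (nu f)) / dotp v (nu f).
(* The step at time tau y f that cancels the jump of 1_K there, where K itself is
   closed: hence the asymmetry between < and <=. *)
Let crossing y f (t : R) : R :=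
  if P f && `[< prism (F f) v y >] then
    if 0 < dotp v (nu f) then (tau y f < t)%R%:R else - (tau y f <= t)%R%:R
  else 0.

Lemma crossing_identity y : (forall j, ~ bad_set j y) ->
  \1_K y + \sum_(f | P f && (0 < dotp v (nu f))) \1_(prism (F f) v) y =
  \1_K (y - v) + \sum_(f | P f && (dotp v (nu f) < 0)) \1_(prism (F f) v) y :> R.
Proof.
move=> good.
have nz f : prism (F f) v y -> dotp v (nu f) != 0.
  move=> Fy; apply/eqP => h; have := good (inr (inl f)); rewrite /= dotpC h eqxx.
  by apply.
have tauE f t : prism (F f) v y -> F f (c y t) -> tau y f = t.
  move=> /nz fy /flatF; rewrite /c /tau dotpDl dotpZl => <-.
  by rewrite addrAC subrr add0r mulfK.
have hitP f : prism (F f) v y -> F f (c y (tau y f)) /\ 0 < tau y f < 1.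
  move=> fy; have /prismP[t /andP[t0 t1] Ft] := fy; rewrite (tauE _ _ fy Ft); split => //.
  rewrite !lt_neqAle t0 t1 !andbT; apply/andP; split; apply/eqP => te.
  - apply: (good (inr (inr (inr f)))) => /=.
    by move: Ft; rewrite -te scale0r addr0.
  - apply: (good (inr (inr (inl f)))) => /=.
    by move: Ft; rewrite te scale1r subrK.
have near_lt (s t : R) : s != t ->
    \forall t' \near t, (s < t') = (s < t) /\ (s <= t') = (s <= t).
  rewrite neq_lt => /orP[st|ts].
    have : \forall t' \near t, s < t' by exact: lt_nbhsr.
    by apply: filterS => t' st'; rewrite st st' !ltW.
  have : \forall t' \near t, t' < s by exact: lt_nbhsl.
  by apply: filterS => t' st'; split; rewrite ?ltNge ?(ltW st') ?(ltW ts) // !leNgt st' ts.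
have near_crossing f t : (P f -> prism (F f) v y -> tau y f != t) ->
    \forall s \near t, crossing y f s = crossing y f t.
  rewrite /crossing; have [/andP[Pf /asboolP fy] /(_ Pf fy) /near_lt|_ _] :=
    boolP (P f && `[< prism (F f) v y >]); last by apply: (@nearW _ (nbhs t)).
  by apply: filterS => s [-> ->].
(* Along the segment [1_K] drops by 1 after an exit and rises by 1 from an entry on; the step of
   that facet makes the opposite move, so [G] is locally constant. *)
pose G t : R := \1_K (c y t) + \sum_f crossing y f t.
have GE : G 0 = G 1.
  apply: locally_constant01 => t t01; rewrite /G.
  case: (pselect (exists2 f, P f & F f (c y t))) => [[f0 Pf0 Ft]|nF]; last first.
    have h1 : \forall s \near t, \1_K (c y s) = \1_K (c y t) :> R.
      apply: near_indic_line => //; rewrite boundaryK => -[f Pf Ff].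
      by apply: nF; exists f.
    have h2 : \forall s \near t, forall f, crossing y f s = crossing y f t.
      apply: (@filter_forall _ _ (fun f s => crossing y f s = crossing y f t)
        (nbhs t) (nbhs_filter t)) => f.
      apply: near_crossing => Pf fy; apply/eqP => tt.
      by apply: nF; exists f => //; rewrite -tt; have [] := hitP _ fy.
    near=> s.
    have -> : \1_K (c y s) = \1_K (c y t) :> R by near: s; exact: h1.
    have E : forall f, crossing y f s = crossing y f t by near: s; exact: h2.
    by congr (_ + _); apply: eq_bigr => f _.
  (* A second facet through this point would make [y] bad, so near [t] only the step of [f0] can
     change. *)
  have core g : g != f0 -> ~ F g (c y t).
    move=> gf Fg; apply: (good (inl (f0, g))) => /=; rewrite eq_sym gf.
    by apply/prismP; exists t.
  have f0y : prism (F f0) v y by apply/prismP; exists t.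
  have h2 : \forall s \near t, forall g, g != f0 -> crossing y g s = crossing y g t.
    apply: (@filter_forall _ _ (fun g s => g != f0 -> crossing y g s = crossing y g t)
      (nbhs t) (nbhs_filter t)) => g.
    have [->|gf] := eqVneq g f0; first exact: nearW.
    apply: filterS (@near_crossing g t _) => // Pg gy; apply/eqP => tt.
    by apply: (core g gf); rewrite -tt; have [] := hitP _ gy.
  have [r r0 Hr] := facet_sides Pf0 Ft core.
  have h1 : \forall s \near t, ball (c y t) r (c y s).
    exact: (@line_continuous R N (y - v) v t _ (nbhsx_ballx _ _ r0)).
  near=> s.
  have bs : ball (c y t) r (c y s) by near: s; exact: h1.
  have E : forall g, g != f0 -> crossing y g s = crossing y g t by near: s; exact: h2.
  rewrite [in LHS](bigD1 f0) //= [in RHS](bigD1 f0) //= !addrA.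
  congr (_ + _); last by apply: eq_bigr => g /E.
  have Kt : K (c y t).
    by have : (K `\` K°) (c y t) by [rewrite boundaryK; exists f0]; case.
  rewrite /crossing Pf0 (asboolT f0y) /= (tauE _ _ f0y Ft) lexx ltxx.
  have [Hm Hp] := Hr _ bs.
  have dE : dotp (c y s - c y t) (nu f0) = (s - t) * dotp v (nu f0).
    by rewrite -dotpZl; congr dotp; rewrite /c scalerBl;
      apply/matrixP => i j; rewrite !mxE; ring.
  rewrite dE in Hm Hp.
  have indT z : K z -> \1_K z = 1 :> R by move=> Kz; rewrite indicE mem_set.
  have indF z : ~ K z -> \1_K z = 0 :> R by move=> Kz; rewrite indicE memNset.
  have [st|ts|->] := ltgtP s t; last by rewrite ?ltxx.
  - have st0 : s - t < 0 by rewrite subr_lt0.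
    case: ifPn => vp.
      have : K (c y s) by apply: Hm; rewrite nmulr_rlt0.
      by move=> /indT ->; rewrite (indT _ Kt).
    have vn : dotp v (nu f0) < 0 by rewrite lt_neqAle nz // leNgt.
    have : ~ K (c y s) by apply: Hp; rewrite nmulr_rgt0.
    by move=> /indF ->; rewrite (indT _ Kt) mulr1n mulr0n; ring.
  - have st0 : 0 < s - t by rewrite subr_gt0.
    case: ifPn => vp.
      have : ~ K (c y s) by apply: Hp; rewrite pmulr_rgt0.
      by move=> /indF ->; rewrite (indT _ Kt) mulr1n mulr0n; ring.
    have vn : dotp v (nu f0) < 0 by rewrite lt_neqAle nz // leNgt.
    have : K (c y s) by apply: Hm; rewrite pmulr_rlt0.
    by move=> /indT ->; rewrite (indT _ Kt).
(* All crossing times lie strictly between 0 and 1: no step has been taken at 0, and all of them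
   have at 1. *)
have G0 : G 0 = \1_K (y - v).
  rewrite /G /c scale0r addr0 big1 ?addr0 // => f _; rewrite /crossing.
  case: ifPn => [/andP[_ /asboolP /hitP[_ /andP[t0 _]]]|//].
  have -> : (tau y f < 0) = false by rewrite ltNge (ltW t0).
  have -> : (tau y f <= 0) = false by rewrite leNgt t0.
  by rewrite oppr0 if_same.
have G1 : G 1 = \1_K y + \sum_(f | P f && (0 < dotp v (nu f))) \1_(prism (F f) v) y
   - \sum_(f | P f && (dotp v (nu f) < 0)) \1_(prism (F f) v) y.
  rewrite /G /c scale1r subrK -addrA; congr (_ + _).
  rewrite !(big_mkcond (fun f => P f && _)) /= -sumrB; apply: eq_bigr => f _.
  rewrite /crossing indicE; case: (P f) => /=; last by rewrite subr0.
  case: asboolP => fy; last by rewrite memNset // !if_same subr0.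
  have [_ /andP[_ t1]] := hitP _ fy; rewrite t1 (ltW t1) mem_set //.
  case: ifPn => vp; first by rewrite ltNge (ltW vp) subr0.
  by rewrite lt_neqAle nz // leNgt vp sub0r.
by rewrite -G0 GE G1 subrK.
Unshelve. all: by end_near. Qed.

(** Empty sets stand for the facets left out, because [intN_sum] has no condition on the indices. *)
Let part (Q : pred I) f := if P f && Q f then prism (F f) v else set0.

Let closed_part Q f : closed (part Q f).
Proof.
rewrite /part; case: ifP => _; last exact: closed0.
by apply: compact_rV_closed; exact: compact_prism.
Qed.

Let sum_part (Q : pred I) y : (\sum_f (\1_(part Q f) y)%:E)%E =
  (\sum_(f | P f && Q f) \1_(prism (F f) v) y : R)%:E.
Proof.
rewrite sumEFin; congr EFin; rewrite [RHS]big_mkcond; apply: eq_bigr => f _.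
by rewrite /part; case: ifP => // _; rewrite indic0.
Qed.

Let lebN_part (Q : pred I) : (\sum_f lebN (part Q f))%E =
  (\sum_(f | P f && Q f) `|dotp v (nu f)| * fine (flat_area (nu f) (F f)))%:E.
Proof.
rewrite [X in X%:E]big_mkcond /= -sumEFin; apply: eq_bigr => f _.
rewrite /part; case: ifP => // _; last first.
  rewrite lebN_intN -[RHS](@intN0 R N); congr intN.
  by apply/funext => w; rewrite indic0.
rewrite (lebN_prism (b := b f) _ (nu1 f)) //; last by move=> x /flatF.
have fin : flat_area (nu f) (F f) \is a fin_num.
  exact: (compact_lebN_fin (compact_prism (v := nu f) (@cF f))).
by rewrite EFinM fineK // (dotpC v).
Qed.

Lemma polyhedron_flux :
  \sum_(f | P f) dotp v (nu f) * fine (flat_area (nu f) (F f)) = 0.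
Proof.
pose Kv := [set y | K (y - v)].
have cKv : closed Kv by exact: closed_translate.
pose side (A : set 'rV[R]_N) (Q : pred I) y :=
  ((\1_A y : R)%:E + \sum_f (\1_(part Q f) y : R)%:E)%E.
have side_int A Q : closed A -> intN (side A Q) = (lebN A + \sum_f lebN (part Q f))%E.
  move=> cA; rewrite intND.
  - rewrite -lebN_intN intN_sum.
      by congr (_ + _)%E; apply: eq_bigr => f _; rewrite lebN_intN.
      by move=> f w; rewrite lee_fin.
    by move=> f; exact: closed_measN.
  - by move=> w; rewrite lee_fin.
  - by move=> w; apply: sume_ge0 => f _; rewrite lee_fin.
  - exact: closed_measN.
  - by apply: measN_sum => f; exact: closed_measN.
have side_ge0 A Q y : (0 <= side A Q y)%E.
  by apply: adde_ge0; [rewrite lee_fin|apply: sume_ge0 => f _; rewrite lee_fin].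
(* One indicator plus at most one per facet: this is the uniform bound that [intN_ae_le] asks
   for. *)
have side_le A Q y : (0 <= side A Q y <= (1 + #|I|%:R)%:E)%E.
  rewrite side_ge0 /= /side sumEFin -EFinD lee_fin.
  apply: lerD; first by rewrite indicE; case: (_ \in _).
  rewrite -sum1_card natr_sum; apply: ler_sum => f _.
  by rewrite indicE; case: (_ \in _).
have side_meas A Q : closed A -> measN (fun _ : unit => side A Q).
  move=> cA; apply: measND; first exact: closed_measN.
  by apply: measN_sum => f; exact: closed_measN.
pose Qp f := 0 < dotp v (nu f); pose Qm f := dotp v (nu f) < 0.
have sideE y : (forall j, ~ bad_set j y) -> side K Qp y = side Kv Qm y.
  move=> /crossing_identity E; rewrite /side !sum_part -!EFinD; congr EFin.
  by rewrite E; congr (_ + _); rewrite !indicE.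
have C0 : 0 <= 1 + #|I|%:R :> R by rewrite addr_ge0.
have E : intN (side K Qp) = intN (side Kv Qm).
  apply/eqP; rewrite eq_le; apply/andP; split.
  - apply: (@intN_ae_le _ _ _ bad_set _ _ (1 + #|I|%:R)) => //; try exact: side_meas.
      exact: closed_bad_set.
    exact: lebN_bad_set.
  - apply: (@intN_ae_le _ _ _ bad_set _ _ (1 + #|I|%:R)) => //; try exact: side_meas.
    + exact: closed_bad_set.
    + exact: lebN_bad_set.
    + by move=> y /sideE.
move: E; rewrite !side_int // !lebN_part lebN_translate //.
rewrite -(fineK (compact_lebN_fin cK)) -!EFinD => -[] /addrI E.
transitivity (\sum_(f | P f && Qp f) `|dotp v (nu f)| * fine (flat_area (nu f) (F f)) -
  \sum_(f | P f && Qm f) `|dotp v (nu f)| * fine (flat_area (nu f) (F f))); last first.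
  by rewrite E subrr.
rewrite !(big_mkcond (fun f => P f && _)) /= -sumrB big_mkcond; apply: eq_bigr => f _.
rewrite /Qp /Qm; case: (P f) => /=; last by rewrite subr0.
have [h|h|h] := ltgtP (dotp v (nu f)) 0.
- by rewrite ltr0_norm // sub0r mulNr opprK.
- by rewrite gtr0_norm // subr0.
- by rewrite h mul0r subr0.
Qed.

End polyhedron.

(** * The Gauss formula for the elements of the mesh *)

Section mesh_divergence.
Context {R : realType} {N : nat} {Omega : set 'rV[R]_N} (M : mesh Omega).

Lemma flat_areaN (n : 'rV[R]_N) S (b : R) : dotp n n = 1 -> compact S ->
  (forall x, S x -> dotp x n = b) -> flat_area (- n) S = flat_area n S.
Proof.
move=> n1 cS Sb; have := lebN_prism (- n) n1 cS Sb.
by rewrite dotpNr n1 normrN normr1 mul1e.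
Qed.

(** By conformity the intersection of two elements lies in a face of [K], hence in the boundary of
    [K]. *)
Lemma elem_disjoint_interior (K L : cell M) x : K != L -> (elem K)° x -> ~ elem L x.
Proof.
move=> KL Kx Lx.
have KLx : (elem K `&` elem L) x by split => //; exact: interior_subset Kx.
case: (elem_conforming KL) => [E|[F [G [F0 _ FK _ [E _]]]]]; first by rewrite E in KLx.
have /set0Pn[f fF] := F0.
have fx : facet f x by move: KLx; rewrite E => /(_ f fF).
have : (elem K `\` (elem K)°) x by rewrite elem_boundary; exists f => //; exact: FK.
by case.
Qed.

Lemma elem_sub_closure (K : cell M) : elem K `<=` closure Omega.
Proof. by move=> x Kx; rewrite (elem_cover M); exists K. Qed.

Definition outward (K : cell M) (f : iface M + bface M) : 'rV[R]_N :=
  match f with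
  | inl s => if inn s == K then normal (inl s) else - normal (inl s)
  | inr b => normal (inr b)
  end.

Lemma outward_cases K f : outward K f = normal f \/ outward K f = - normal f.
Proof. by case: f => [s|b] /=; [case: ifP; [left|right]|left]. Qed.

Lemma elem_flux (K : cell M) (v : 'rV[R]_N) :
  \sum_(f | is_face_of f K) dotp v (outward K f) * area f = 0.
Proof.
have /choice[b0 b0E] := @facet_flat _ _ _ M.
pose b f := if outward K f == normal f then b0 f else - b0 f.
have flat f x : facet f x -> dotp x (outward K f) = b f.
  move=> fx; rewrite /b; case: eqP => [->|h]; first exact: b0E.
  by case: (outward_cases K f) => // ->; rewrite dotpNr b0E.
have nu1 f : dotp (outward K f) (outward K f) = 1.
  by case: (outward_cases K f) => ->; rewrite ?dotpNr ?dotpNl ?opprK normal_unit.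
have aE f S : compact S -> (forall x, S x -> dotp x (normal f) = b0 f) ->
    flat_area (outward K f) S = flat_area (normal f) S.
  by move=> cS Sb; case: (outward_cases K f) => -> //;
    apply: (flat_areaN (normal_unit f) cS Sb).
have := @polyhedron_flux R N _ (elem K) (@facet _ _ _ M) (outward K) b
  (fun f => is_face_of f K) v (@elem_compact R N Omega M K) (elem_boundary K)
  (@facet_compact _ _ _ M)
  nu1 flat.
have ov f g : f != g -> flat_area (outward K f) (facet f `&` facet g) = 0%E.
  move=> fg; rewrite aE ?facet_overlap //.
    apply: compact_closedI; first exact: facet_compact.
    by apply: compact_rV_closed; exact: facet_compact.
  by move=> x [/b0E].
move=> /(_ ov); rewrite -[X in _ -> X = _]/(\sum_(f | is_face_of f K) _).
move=> H; rewrite -[RHS]H.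
  apply: eq_bigr => f _; rewrite /area aE //; first exact: facet_compact.
  exact: b0E.
move=> f x fK fx core.
have fc : facet_core f x by split.
case: f fK fx core fc => [s|bf] /= fK fx core fc.
(* Beyond the face lies the interior of the other element, which is disjoint from [K]. *)
- have sides := iface_sides fc.
  case: ifPn => [/eqP sK|sK].
    move: sides; apply: filterS => d [h1 h2]; rewrite -sK; split => //.
    by apply: (elem_disjoint_interior _ h2); rewrite eq_sym inn_out_neq.
  have {}fK : K = out s by move: fK => /orP[/eqP E|/eqP //]; move: sK; rewrite E eqxx.
  move: sides; apply: filterS => d [h1 h2]; rewrite fK scalerN opprK; split => //.
  by apply: (elem_disjoint_interior _ h1); exact: inn_out_neq.
- have := bface_sides fc; apply: filterS => d; rewrite (eqP fK) => -[h1 h2]; split => //.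
  by move=> /elem_sub_closure.
Qed.

(** The boundary faces drop out of [elem_flux] by the hypothesis on [v]; on the interior faces the
    incidence factor is the sign that turns the fixed normal outward. *)
Lemma mesh_divergence (K : cell M) (v : 'rV[R]_N) :
  (forall bf, K = bin bf -> dotp v (normal (inr bf)) = 0) ->
  \sum_s area (inl s) * ((inn s == K)%:R - (out s == K)%:R) * dotp v (nrm s) = 0.
Proof.
move=> noflux; rewrite -[RHS](elem_flux K v) big_sumType /=.
rewrite [X in _ = _ + X]big1 ?addr0; last first.
  by move=> bf /eqP Kb; rewrite noflux ?mul0r.
rewrite [RHS]big_mkcond; apply: eq_bigr => s _ /=.
rewrite /nrm (eq_sym K) (eq_sym K).
have [Ki|Ki] := eqVneq (inn s) K; have [Ko|Ko] := eqVneq (out s) K => /=.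
- by have := inn_out_neq s; rewrite Ki Ko eqxx.
- by rewrite subr0 mulr1 mulrC.
- by rewrite sub0r mulrN1 mulNr dotpNr mulNr mulrC.
- by rewrite subrr mulr0 mul0r.
Qed.

End mesh_divergence.

(** * Entropy balance *)

Section face_algebra.
Context {R : realType} {N : nat}.

(* Entropy produced in a cell with density r0 and temperature t0 by the exchange,
   with transport weight w, with a neighbour of density r1 and temperature t1;
   J is the squared velocity jump and H the viscosity h^(alpha-1). *)
Definition production (c H w r0 r1 t0 t1 J : R) : R :=
  w * (t0 * r0 - (c + 1) * t0 * r1 + c * r1 * t1) + 2^-1 * (w * r1 + H) * J.

(** The contribution of one face to energy minus momentum plus mass, after testing, as a polynomial
    identity: [aa] stands for the absolute value of [a] but is left free. The last bracket on the
    right is a difference of two one-sided terms, which [faces_cancel] removes after summation. *)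
Lemma face_entropy_identity (ui uo n : 'rV[R]_N) (ri ro ti t_o psi pso nu aa c H : R) :
  let a := dotp (2^-1 *: (ui + uo)) n in
  let flx (r0 r1 : R) := 2^-1 * (r0 + r1) * a - 2^-1 * aa * (r1 - r0) - nu * (r1 - r0) in
  let vflx (r0 r1 : 'rV[R]_N) :=
    a *: (2^-1 *: (r0 + r1)) - (2^-1 * aa) *: (r1 - r0) - nu *: (r1 - r0) in
  let e r t (u : 'rV[R]_N) := c * r * t + 2^-1 * r * dotp u u in
  let J := dotp (uo - ui) (uo - ui) in
  (flx (e ri ti ui) (e ro t_o uo) * (pso - psi)
   + 2^-1 * (ri * ti + ro * t_o) * dotp (pso *: uo - psi *: ui) n
   - 2^-1 * (ri * ti * psi + ro * t_o * pso) * dotp (uo - ui) n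
   - H * (dotp (uo - ui) (2^-1 *: (ui + uo)) * (pso - psi)))
  - (dotp (vflx (ri *: ui) (ro *: uo)) (pso *: uo - psi *: ui)
     + 2^-1 * (ri * ti + ro * t_o) * dotp n (pso *: uo - psi *: ui)
     - H * dotp (uo - ui) (pso *: uo - psi *: ui))
  + flx ri ro * ((2^-1 * dotp uo uo - (c + 1) * t_o) * pso
                 - (2^-1 * dotp ui ui - (c + 1) * ti) * psi)
  = psi * production c H (2^-1 * (aa - a) + nu) ri ro ti t_o J
  + pso * production c H (2^-1 * (aa + a) + nu) ro ri t_o ti J
  + (ri * ti * psi * dotp ui n - ro * t_o * pso * dotp uo n).
Proof.
rewrite /= /production.
rewrite !(dotpDl, dotpBl, dotpZl, dotpNl, dotpDr, dotpBr, dotpZr, dotpNr).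
rewrite (dotpC uo ui) !(dotpC n).
by field.
Qed.

End face_algebra.

Section balance.
Context {R : realType} {N : nat} {Omega : set 'rV[R]_N} (M : mesh Omega).
Variables (gamma alpha h : R) (mu : iface M -> R).
Variables (rho : cell M -> R) (m : cell M -> 'rV[R]_N) (E : cell M -> R).
Variables (drho : cell M -> R) (dm : cell M -> 'rV[R]_N) (dE : cell M -> R).
Let u := velocity rho m.
Let p := pressure gamma rho m E.
Let theta := temperature gamma rho m E.
Let c := (gamma - 1)^-1.
Let H := h `^ (alpha - 1).
Hypothesis gamma1 : 1 < gamma.
Hypothesis rho0 : forall K, 0 < rho K.
Hypothesis noflux : forall b, dotp (u (bin b)) (normal (inr b)) = 0.
Hypothesis eqC : continuity_eq mu rho m drho.
Hypothesis eqM : momentum_eq gamma alpha h mu rho m E dm.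
Hypothesis eqE : energy_eq gamma alpha h mu rho m E dE.

(* Upwind weights of the flux from inn s to out s and back. *)
Definition wio s : R := 2^-1 * (`|avg_n u s| + avg_n u s) + mu s.
Definition woi s : R := 2^-1 * (`|avg_n u s| - avg_n u s) + mu s.

Lemma momentumE K : m K = rho K *: u K.
Proof. by rewrite /u /velocity scalerA divff ?scale1r // gt_eqF. Qed.

Lemma pressureE K : p K = rho K * theta K.
Proof. by rewrite /theta /temperature mulrC divfK // gt_eqF. Qed.

Lemma energyE K : E K = c * rho K * theta K + 2^-1 * rho K * dotp (u K) (u K).
Proof.
have g0 : gamma - 1 != 0 by rewrite subr_eq0 gt_eqF.
have r0 : rho K != 0 by rewrite gt_eqF.
rewrite /theta /temperature /pressure /sqnorm momentumE dotpZl dotpZr /c; field.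
by rewrite r0 g0.
Qed.

(** Regrouped by element, the sum is [X K] times the flux through the faces of [K] of the constant
    field [u K]. *)
Lemma faces_cancel (X : cell M -> R) :
  int_faces (fun s => X (inn s) * dotp (u (inn s)) (nrm s)
                    - X (out s) * dotp (u (out s)) (nrm s)) = 0.
Proof.
rewrite /int_faces.
transitivity (\sum_K X K * \sum_s area (inl s) * ((inn s == K)%:R - (out s == K)%:R)
   * dotp (u K) (nrm s)); last first.
  rewrite big1 // => K _; rewrite mesh_divergence ?mulr0 // => b ->; exact: noflux.
under [RHS]eq_bigr do rewrite mulr_sumr.
rewrite exchange_big /=; apply: eq_bigr => s _.
rewrite (bigD1 (inn s)) //= (bigD1 (out s)) //=; last by rewrite eq_sym inn_out_neq.
rewrite big1 => [|K /andP[Ki Ko]]; last first.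
  by rewrite (eq_sym _ K) (negbTE Ki) (eq_sym _ K) (negbTE Ko) subrr mulr0 mul0r mulr0.
have oi : (out s == inn s) = false by rewrite eq_sym; exact/negbTE/inn_out_neq.
by rewrite !eqxx oi (negbTE (inn_out_neq s)) mulr1n mulr0n; ring.
Qed.

(** The first three terms are the time derivative of the internal energy [c rho theta]; with the
    last one the total is [c rho theta' - theta rho'], that is [rho theta] times the derivative of
    the entropy. *)
Definition entropy_rate K : R :=
  dE K - dotp (dm K) (u K) + 2^-1 * sqnorm (u K) * drho K - (c + 1) * theta K * drho K.

(** The energy equation tested with [psi], minus the momentum equation with [psi u], plus the mass
    equation with [psi (|u|^2 / 2 - (c + 1) theta)]. The weight stays free: the indicator of a cell
    serves the minimum principle, [1 / theta] the total entropy. *)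
Lemma entropy_balance (psi : cell M -> R) :
  int_dom (fun K => entropy_rate K * psi K) =
  int_faces (fun s =>
    psi (inn s) * production c H (woi s) (rho (inn s)) (rho (out s))
       (theta (inn s)) (theta (out s)) (sqnorm (jump u s))
  + psi (out s) * production c H (wio s) (rho (out s)) (rho (inn s))
       (theta (out s)) (theta (inn s)) (sqnorm (jump u s))).
Proof.
have C := eqC (fun K => (2^-1 * dotp (u K) (u K) - (c + 1) * theta K) * psi K).
have Mo := eqM (fun K => psi K *: u K).
have En := eqE psi.
have D := faces_cancel (fun K => rho K * theta K * psi K).
have -> : int_dom (fun K => entropy_rate K * psi K) =
  int_dom (fun K => dE K * psi K) - int_dom (fun K => dotp (dm K) (psi K *: u K))
  + int_dom (fun K => drho K * ((2^-1 * dotp (u K) (u K) - (c + 1) * theta K) * psi K)).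
  rewrite /int_dom -sumrB -big_split; apply: eq_bigr => K _ /=.
  rewrite /entropy_rate dotpZr /sqnorm; ring.
move/eqP: C; rewrite subr_eq0 => /eqP ->.
rewrite (_ : int_dom (fun K => dE K * psi K) =
    int_faces (fun s => flux mu E u s * jump psi s)
  + int_faces (fun s => avg p s * dotp (jump (fun K => psi K *: u K) s) (nrm s))
  - int_faces (fun s => avg (fun K => p K * psi K) s * dotp (jump u s) (nrm s))
  - H * int_faces (fun s => dotp (jump u s) (vavg u s) * jump psi s)); last first.
  by move: En; rewrite -/u -/p -/H; lra.
rewrite (_ : int_dom (fun K => dotp (dm K) (psi K *: u K)) =
    int_faces (fun s => dotp (vflux mu m u s) (jump (fun K => psi K *: u K) s))
  + int_faces (fun s => avg p s * dotp (nrm s) (jump (fun K => psi K *: u K) s))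
  - H * int_faces (fun s => dotp (jump u s) (jump (fun K => psi K *: u K) s))); last first.
  by move: Mo; rewrite -/u -/p -/H; lra.
rewrite -[RHS]addr0 -D /int_faces !mulr_sumr -!(sumrB, big_split) /=.
apply: eq_bigr => s _.
have := face_entropy_identity (u (inn s)) (u (out s)) (nrm s) (rho (inn s)) (rho (out s))
  (theta (inn s)) (theta (out s)) (psi (inn s)) (psi (out s)) (mu s) `|avg_n u s| c H.
rewrite /= -!energyE -!momentumE.
rewrite /flux /Up /vflux /vUp /avg /vavg /jump /wio /woi /avg_n /vavg /sqnorm !pressureE.
move=> I; rewrite -[RHS]mulrDr -I; ring.
Qed.

End balance.

(** * Entropy production of a face *)

Section production_bounds.
Context {R : realType}.

Lemma ln_le_subr1 (x : R) : 0 < x -> ln x <= x - 1.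
Proof. by move=> x0; have := expR_ge1Dx (ln x); rewrite lnK //; lra. Qed.

(* ln x = 2 ln (sqrt x) <= 2 (sqrt x - 1) *)
Lemma sub1_ln_ge (x : R) : 0 < x -> (x - 1) ^+ 2 / (2 * (x + 1)) <= x - 1 - ln x.
Proof.
move=> x0; set y := Num.sqrt x.
have y0 : 0 < y by rewrite sqrtr_gt0.
have xE : x = y ^+ 2 by rewrite sqr_sqrtr // ltW.
have lnE : ln x = 2 * ln y.
  by rewrite xE expr2 lnM ?posrE // mulr2n mulrDl mul1r.
have := ln_le_subr1 y0; rewrite lnE => lny.
apply: (@le_trans _ _ ((y - 1) ^+ 2)); last by rewrite xE; nra.
rewrite ler_pdivrMr; last by lra.
have -> : (x - 1) ^+ 2 = (y - 1) ^+ 2 * (y + 1) ^+ 2 by rewrite xE; ring.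
apply: ler_wpM2l; first exact: sqr_ge0.
rewrite xE; have := sqr_ge0 (y - 1); nra.
Qed.

Variables (c H w r0 r1 t0 t1 J : R).
Hypotheses (c0 : 0 < c) (H0 : 0 <= H) (w0 : 0 <= w) (J0 : 0 <= J).
Hypotheses (r0p : 0 < r0) (r1p : 0 < r1) (t0p : 0 < t0) (t1p : 0 < t1).
Let s0 := c * ln t0 - ln r0.
Let s1 := c * ln t1 - ln r1.

(** The logarithms cancel because [s1 - s0 = c ln (t1 / t0) + ln (r0 / r1)]. *)
Let productionE : production c H w r0 r1 t0 t1 J / t0 = w * r1 * (s1 - s0)
  + w * (r1 * (r0 / r1 - 1 - ln (r0 / r1)))
  + w * (c * r1 * (t1 / t0 - 1 - ln (t1 / t0)))
  + 2^-1 * (w * r1 + H) * J / t0.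
Proof.
have t0n : t0 != 0 by rewrite gt_eqF.
have r1n : r1 != 0 by rewrite gt_eqF.
rewrite /production /s0 /s1 !ln_div ?posrE //; field.
by rewrite t0n r1n.
Qed.

Let viscous_ge0 : 0 <= 2^-1 * (w * r1 + H) * J / t0.
Proof.
apply: divr_ge0; last exact: ltW.
by rewrite !mulr_ge0 ?addr_ge0 ?mulr_ge0 ?invr_ge0 // ltW.
Qed.

Lemma production_ge_transport :
  t0 * (w * r1 * (s1 - s0)) <= production c H w r0 r1 t0 t1 J.
Proof.
rewrite mulrC -ler_pdivlMr // productionE -!addrA lerDl.
have a1 := ln_le_subr1 (divr_gt0 r0p r1p).
have a2 := ln_le_subr1 (divr_gt0 t1p t0p).
apply: addr_ge0; last apply: addr_ge0 => //.
- by apply: mulr_ge0 => //; apply: mulr_ge0; [exact: ltW|lra].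
- apply: mulr_ge0 => //; apply: mulr_ge0; last by lra.
  by rewrite mulr_ge0 ?ltW.
Qed.

(** The two remainders are bounded below by [sub1_ln_ge], whose denominators become [2 (r0 + r1)]
    and [2 t0 (t0 + t1)] after clearing fractions; hence [4 rup] and [4 tup^2]. Of the viscous
    heating only the part with [H] is kept. *)
Lemma production_ge_dissipation (rlow rup tup : R) :
  0 < rlow -> rlow <= r1 -> r0 <= rup -> r1 <= rup -> t0 <= tup -> t1 <= tup ->
  w * r1 * (s1 - s0) + w * ((r1 - r0) ^+ 2 / (4 * rup))
   + w * (c * rlow * (t1 - t0) ^+ 2 / (4 * tup ^+ 2)) + H * J / (2 * tup)
  <= production c H w r0 r1 t0 t1 J / t0.
Proof.
move=> rl0 rl r0u r1u t0u t1u.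
have t0n : t0 != 0 by rewrite gt_eqF.
have r1n : r1 != 0 by rewrite gt_eqF.
have up : 0 < tup by exact: lt_le_trans t0u.
have rp : 0 < rup by exact: lt_le_trans r0u.
rewrite productionE; apply: lerD; first apply: lerD; first apply: lerD => //.
- apply: ler_wpM2l => //.
  have h1 := sub1_ln_ge (divr_gt0 r0p r1p).
  rewrite -(ler_pM2l r1p) in h1; apply: (le_trans _ h1).
  have -> : r1 * ((r0 / r1 - 1) ^+ 2 / (2 * (r0 / r1 + 1))) =
    (r1 - r0) ^+ 2 / (2 * (r0 + r1)).
    have rs : r0 + r1 != 0 by rewrite gt_eqF // addr_gt0.
    by field; rewrite rs r1n.
  apply: ler_wpM2l; first exact: sqr_ge0.
  rewrite lef_pV2 ?posrE ?mulr_gt0 ?addr_gt0 //. lra.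
- apply: ler_wpM2l => //.
  have h1 := sub1_ln_ge (divr_gt0 t1p t0p).
  have cr1 : 0 < c * r1 by rewrite mulr_gt0.
  rewrite -(ler_pM2l cr1) in h1; apply: (le_trans _ h1).
  have -> : c * r1 * ((t1 / t0 - 1) ^+ 2 / (2 * (t1 / t0 + 1))) =
    c * r1 * (t1 - t0) ^+ 2 / (2 * t0 * (t1 + t0)).
    have ts : t1 + t0 != 0 by rewrite gt_eqF // addr_gt0.
    by field; rewrite t0n ts.
  apply: ler_pM.
  + by rewrite mulr_ge0 ?sqr_ge0 // mulr_ge0 ?ltW.
  + by rewrite invr_ge0 mulr_ge0 // sqr_ge0.
  + by rewrite ler_wpM2r ?sqr_ge0 // ler_pM2l.
  + have a1 : t0 * t0 <= tup * tup by apply: ler_pM => //; exact: ltW.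
    have a2 : t0 * t1 <= tup * tup by apply: ler_pM => //; exact: ltW.
    by rewrite lef_pV2 ?posrE ?mulr_gt0 ?addr_gt0 ?exprn_gt0 // expr2; lra.
- have h1 : 0 <= w * r1 * J by rewrite !mulr_ge0 // ltW.
  have -> : 2^-1 * (w * r1 + H) * J / t0 = (w * r1 * J + H * J) / (2 * t0).
    by field; rewrite t0n.
  apply: ler_pM.
  + by rewrite mulr_ge0.
  + by rewrite invr_ge0 mulr_ge0 // ltW.
  + by rewrite lerDr.
  + by rewrite lef_pV2 ?posrE ?mulr_gt0 // ler_pM2l.
Qed.

End production_bounds.

(** * Differentiation rules for functions of time *)

Section calculus.
Context {R : realType}.
Implicit Types (f g : R -> R) (x a b : R).

Lemma is_derive_val f x a b : is_derive x 1 f a -> a = b -> is_derive x 1 f b.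
Proof. by move=> + <-. Qed.

Lemma is_deriveM_pt f g x a b : is_derive x 1 f a -> is_derive x 1 g b ->
  is_derive x 1 (fun t => f t * g t) (a * g x + f x * b).
Proof.
move=> hf hg; apply: (is_derive_val (is_deriveM hf hg)).
by rewrite /GRing.scale /= addrC mulrC.
Qed.

Lemma is_deriveB_pt f g x a b : is_derive x 1 f a -> is_derive x 1 g b ->
  is_derive x 1 (fun t => f t - g t) (a - b).
Proof. by move=> hf hg; exact: (is_deriveB hf hg). Qed.

Lemma is_deriveD_pt f g x a b : is_derive x 1 f a -> is_derive x 1 g b ->
  is_derive x 1 (fun t => f t + g t) (a + b).
Proof. by move=> hf hg; exact: (is_deriveD hf hg). Qed.

Lemma is_derive_cmul k f x a : is_derive x 1 f a ->
  is_derive x 1 (fun t => k * f t) (k * a).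
Proof.
move=> hf; apply: (is_derive_val (is_deriveM_pt (is_derive_cst k x 1) hf)).
by rewrite mul0r add0r.
Qed.

Lemma is_derive_ln_pt f x a : 0 < f x -> is_derive x 1 f a ->
  is_derive x 1 (fun t => ln (f t)) (a / f x).
Proof.
move=> fx hf; apply: (is_derive_val (is_derive1_comp (is_derive1_ln fx) hf)).
by rewrite mulrC.
Qed.

Lemma is_deriveV_pt f x a : f x != 0 -> is_derive x 1 f a ->
  is_derive x 1 (fun t => (f t)^-1) (- a / f x ^+ 2).
Proof.
move=> fx hf; apply: (is_derive_val (is_deriveV fx hf)).
by rewrite /GRing.scale /= mulNr mulrC mulNr.
Qed.

Lemma is_derive_sum_pt (I : Type) (s : seq I) (f : I -> R -> R) x (a : I -> R) :
  (forall i, is_derive x 1 (f i) (a i)) ->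
  is_derive x 1 (fun t => \sum_(i <- s) f i t) (\sum_(i <- s) a i).
Proof.
move=> hf; elim: s => [|i s IH].
  rewrite big_nil (_ : (fun t => _) = cst 0); first exact: is_derive_cst.
  by apply/funext => t; rewrite big_nil.
rewrite big_cons (_ : (fun t => _) = fun t => f i t + \sum_(i <- s) f i t).
  exact: is_deriveD_pt.
by apply/funext => t; rewrite big_cons.
Qed.

(** Backward quotients suffice, so the minimum over an interval may sit at its right end. *)
Lemma left_min_derive_le0 f x a : 0 < x -> is_derive x 1 f a ->
  (forall t, 0 <= t <= x -> f x <= f t) -> a <= 0.
Proof.
move=> x0 [df fE] fmin; rewrite leNgt; apply/negP => a0.
have h : h^-1 *: (f (h *: 1 + x) - f x) @[h --> 0^'] --> a.
  by rewrite -fE; exact: df.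
have : nbhs (0 : R) (fun h => h != 0 -> 0 < h^-1 *: (f (h *: 1 + x) - f x)).
  exact: (cvgr_gt _ h _ a0).
move=> /nbhs_ballP[r /= r0 Hr].
pose d := Num.min (r / 2) x.
have d0 : 0 < d by rewrite lt_min x0 andbT divr_gt0.
have dr : d < r by rewrite gt_min; apply/orP; left; lra.
have dx : d <= x by rewrite ge_min lexx orbT.
have := Hr (- d); rewrite /= /ball /= sub0r opprK (gtr0_norm d0) => /(_ dr).
rewrite oppr_eq0 gt_eqF // => /(_ isT).
rewrite /GRing.scale /= mulr1 invrN mulNr oppr_gt0 pmulr_rlt0 ?invr_gt0 //.
rewrite ltNge subr_ge0 fmin //; apply/andP; split; lra.
Qed.

End calculus.

(** * Increments of functions with nonnegative derivative *)

Section increment.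
Context {R : realType}.
Local Notation mu := (@lebesgue_measure R).

Lemma integral_bounded_itv (a : R -> R) (L x y : R) (b1 b2 : bool) : x <= y ->
  measurable_fun [set: measurableTypeR R] a -> (forall t, 0 <= a t <= L) ->
  (\int[mu]_(t in [set` Interval (BSide b1 x) (BSide b2 y)]) (a t)%:E <= ((y - x) * L)%:E)%E.
Proof.
move=> xy ma aL.
pose I := Interval (BSide b1 x) (BSide b2 y).
have mD : measurable ([set` I] : set (measurableTypeR R)) by exact: measurable_itv.
have intL : (\int[mu]_(t in [set` I]) (cst L%:E) t <= ((y - x) * L)%:E)%E.
  rewrite integral_cst //= lebesgue_measure_itv /= lte_fin.
  case: ifPn => h; first by rewrite -EFinD -EFinM mulrC.
  rewrite mule0 lee_fin mulr_ge0 ?subr_ge0 //.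
  by have /andP[/le_trans h1 /h1] := aL 0.
apply: le_trans intL; apply: ge0_le_integral => //.
- by move=> t _; rewrite lee_fin; have /andP[] := aL t.
- by apply/measurable_EFinP; exact: measurable_funS ma.
- by move=> t _; rewrite lee_fin; have /andP[] := aL t.
Qed.

(** The shift moves the domain to []d, T + d[], of which only a piece of length [d] sticks out of
    []0, T[]. *)
Lemma integral_shift_le (a : R -> R) (L T d : R) : 0 < T -> 0 < d ->
  measurable_fun [set: measurableTypeR R] a -> (forall t, 0 <= a t <= L) ->
  (\int[mu]_(t in `]0%R, T[) (a (t + d)%R)%:E <=
   \int[mu]_(t in `]0%R, T[) (a t)%:E + (d * L)%:E)%E.
Proof.
move=> T0 d0 ma aL.
pose A t := (a t)%:E.
have mA (D : set (measurableTypeR R)) : measurable D -> measurable_fun D A.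
  by move=> mD; apply/measurable_EFinP; exact: measurable_funS ma.
have A0 t : (0 <= A t)%E by rewrite lee_fin; have /andP[] := aL t.
have shiftE : (\int[mu]_(t in `]0%R, T[) A (t + d)%R =
    \int[mu]_(t in `](0 + d)%R, (T + d)%R[) A t)%E.
  rewrite [LHS]integral_mkcond [RHS]integral_mkcond.
  rewrite -[RHS](ge0_integral_affine d (oner_neq0 _)).
  - rewrite normr1 mul1e; apply: eq_integral => t _.
    rewrite !patchE mul1r.
    have -> : (t + d \in `](0 + d), (T + d)[%classic) = (t \in `]0, T[%classic).
      by apply/idP/idP => /set_mem h; apply/mem_set; move: h => /=;
        rewrite !in_itv /= !ltrD2r.
    by [].
  - apply/(measurable_restrict _ _ _) => //; rewrite setTI.
    exact: mA.
  - by move=> t; rewrite patchE; case: ifP.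
rewrite -/(A _) shiftE.
apply: (@le_trans _ _ (\int[mu]_(t in `]0%R, T[ `|` `[T, (T + d)%R[) A t)%E).
  apply: ge0_subset_integral => //.
  - exact: measurableU.
  - by apply: mA; exact: measurableU.
  - move=> t /=; rewrite !in_itv /= => /andP[t1 t2].
    have [tT|tT] := ltP t T; [left|right] => //; apply/andP; split => //; lra.
rewrite ge0_integral_setU //.
- apply: leeD => //.
  have Td : T <= T + d by rewrite lerDl ltW.
  have := integral_bounded_itv true true Td ma aL.
  by rewrite addrAC subrr add0r.
- by apply: mA; exact: measurableU.
- apply/disj_setPS => t [] /=; rewrite !in_itv /= => /andP[_ t1] /andP[t2 _].
  by rewrite ltNge t2 in t1.
Qed.

(** The error [d L] of the shift is divided by [d]: a bound uniform in [d], as Fatou's lemma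
    needs. *)
Lemma integral_quotient_le (a : R -> R) (L T d : R) : 0 < T -> 0 < d ->
  measurable_fun [set: measurableTypeR R] a -> (forall t, 0 <= a t <= L) ->
  (forall t, a t <= a (t + d)) ->
  (\int[mu]_(t in `]0%R, T[) (d^-1 * (a (t + d) - a t))%:E <= L%:E)%E.
Proof.
move=> T0 d0 ma aL amono.
have I1 := integral_shift_le T0 d0 ma aL.
set D := `]0, T[%classic in I1 *.
have mD : measurable (D : set (measurableTypeR R)) by exact: measurable_itv.
have maD : measurable_fun (D : set (measurableTypeR R)) a by exact: measurable_funS ma.
have mad : measurable_fun (D : set (measurableTypeR R)) (fun t => a (t + d)).
  apply: (measurable_funS (E := setT)) => //.
  apply: (measurableT_comp (f := (a : measurableTypeR R -> R))
    (g := fun t : measurableTypeR R => t + d)) => //.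
  by apply: measurable_funD.
pose f t := (d^-1 * (a (t + d) - a t))%:E.
have f0 t : (0 <= f t)%E by rewrite lee_fin mulr_ge0 ?invr_ge0 ?subr_ge0 // ltW.
have mf : measurable_fun (D : set (measurableTypeR R)) f.
  by apply/measurable_EFinP; apply: measurable_funM => //; exact: measurable_funB.
have a0 t : (0 <= (a t)%:E)%E by rewrite lee_fin; have /andP[] := aL t.
have I2 : (\int[mu]_(t in D) (a (t + d)%R)%:E =
    d%:E * \int[mu]_(t in D) f t + \int[mu]_(t in D) (a t)%:E)%E.
  rewrite -ge0_integralZl //; last by rewrite lee_fin ltW.
  rewrite -ge0_integralD //.
  - apply: eq_integral => t _; rewrite /f -EFinM -EFinD mulrA divff ?gt_eqF //.
    by rewrite mul1r subrK.
  - by move=> t _; rewrite mule_ge0 // lee_fin ltW.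
  - exact: measurable_funeM.
  - exact/measurable_EFinP.
have Afin : (\int[mu]_(t in D) (a t)%:E)%E \is a fin_num.
  rewrite ge0_fin_numE; last by apply: integral_ge0 => t _.
  exact: le_lt_trans (integral_bounded_itv false true (ltW T0) ma aL) (ltry _).
move: I1; rewrite I2 addeC leeD2rE // EFinM.
by rewrite lee_pmul2l // lte_fin.
Qed.

Lemma cvg_forward_quotient (F : R -> R) (t D : R) : is_derive t 1 F D ->
  n.+1%:R * (F (t + n.+1%:R^-1) - F t) @[n --> \oo] --> D.
Proof.
move=> [dF FE].
have h : h^-1 *: (F (h *: 1 + t) - F t) @[h --> 0^'] --> D by rewrite -FE; exact: dF.
have c : (fun n => n.+1%:R^-1 : R) @ \oo --> 0^'.
  move=> A hA; have := @cvg_harmonic R _ hA.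
  by apply: (@filterS _ \oo) => n; apply; rewrite invr_eq0 pnatr_eq0.
have := cvg_comp _ _ c h.
rewrite (_ : _ \o _ = fun n => n.+1%:R * (F (t + n.+1%:R^-1) - F t)) //.
by apply/funext => n /=; rewrite invrK /GRing.scale /= mulr1 (addrC t).
Qed.

Lemma limn_einf_le (u : (\bar R)^nat) (l : \bar R) :
  (forall n, u n <= l)%E -> (limn_einf u <= l)%E.
Proof.
move=> ul; rewrite limn_einf_lim; apply: lime_le; first exact: is_cvg_einfs.
apply: nearW => n; apply: le_trans (ul n).
by apply: ereal_inf_lbound; exists n => /=.
Qed.

(* Fatou's lemma for the difference quotients of F, extended by constants outside [0, T]. *)
Lemma integral_le_increment (T : R) (F dF g : R -> R) : 0 < T ->
  {within `[0, T], continuous F} ->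
  (forall t, 0 < t < T -> is_derive t 1 F (dF t)) ->
  (forall t, 0 < t < T -> 0 <= g t <= dF t) ->
  measurable_fun (`[0, T]%classic : set (measurableTypeR R)) g ->
  (\int[mu]_(t in `[0%R, T]) (g t)%:E <= (F T - F 0)%:E)%E.
Proof.
move=> T0 cF dFE gdF mg.
have Fmono x y : 0 <= x -> x <= y -> y <= T -> F x <= F y.
  move=> x0 xy yT.
  apply: (@ger0_derive1_le_cc _ F 0 T) => //.
  - by move=> t; rewrite in_itv /= => /dFE [].
  - move=> t; rewrite in_itv /= => tT; have [_] := dFE _ tT.
    by rewrite derive1E => ->; have /andP[/le_trans] := gdF _ tT; apply.
  - by rewrite in_itv /= x0 (le_trans xy).
  - by rewrite in_itv /= yT (le_trans x0).
(* Clamping makes [a] monotone on the whole line with values in [[0, L]], so [t + 1/(n+1)] may leave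
   [[0, T]]; monotonicity also gives measurability. *)
pose clamp t := Num.max 0 (Num.min t T).
have clamp0 t : 0 <= clamp t by rewrite le_max lexx.
have clampT t : clamp t <= T by rewrite ge_max (ltW T0) /= ge_min lexx orbT.
have clampE t : 0 <= t <= T -> clamp t = t.
  by move=> /andP[t0 tT]; rewrite /clamp min_l // max_r.
have clamp_mono x y : x <= y -> clamp x <= clamp y.
  by move=> xy; apply: (le_max2 (lexx _)); exact: (le_min2 xy (lexx _)).
pose a t := F (clamp t) - F 0.
set L := F T - F 0.
have aL t : 0 <= a t <= L by rewrite subr_ge0 Fmono //= lerB // Fmono.
have amono x y : x <= y -> a x <= a y by move=> xy; rewrite lerB // Fmono // clamp_mono.
have ma : measurable_fun [set: measurableTypeR R] a by exact: nondecreasing_measurable.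
set D := `]0, T[%classic.
have mD : measurable (D : set (measurableTypeR R)) by exact: measurable_itv.
pose f n t := (n.+1%:R^-1^-1 * (a (t + n.+1%:R^-1) - a t))%:E.
have n0 n : 0 < n.+1%:R^-1 :> R by rewrite invr_gt0.
have mf n : measurable_fun (D : set (measurableTypeR R)) (f n).
  apply/measurable_EFinP; apply: measurable_funM => //; apply: measurable_funB.
    apply: nondecreasing_measurable => // x y xy.
    by apply: amono; rewrite lerD2r.
  exact: nondecreasing_measurable.
have f0 n t : D t -> (0 <= f n t)%E.
  by move=> _; rewrite lee_fin invrK mulr_ge0 // subr_ge0 amono // lerDl ltW.
rewrite integral_itv_bndoo; last first.
  apply/measurable_EFinP; apply: measurable_funS mg => //.
  exact: subset_itv_oo_cc.
rewrite -/D.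
apply: (@le_trans _ _ (\int[mu]_(t in D) limn_einf (f^~ t))%E).
  apply: ge0_le_integral => //.
  - by move=> t; rewrite /D /= in_itv /= => /gdF /andP[g0 _]; rewrite lee_fin.
  - apply/measurable_EFinP; apply: measurable_funS mg => //.
    exact: subset_itv_oo_cc.
  - rewrite (_ : (fun t => _) = fun t => (- limn_esup (-%E \o f^~ t))%E); last first.
      by apply/funext => t; rewrite limn_esupN oppeK.
    apply: measurableT_comp => //; apply: measurable_fun_limn_esup => n.
    exact: measurableT_comp.
  - move=> t; rewrite /D /= in_itv /= => tT.
    have /andP[t0 tT'] := tT.
    have cv : f^~ t @ \oo --> (dF t)%:E.
      apply: cvg_EFin; first by apply: nearW.
      have := cvg_forward_quotient (dFE _ tT); apply: cvg_trans.
      apply: near_eq_cvg.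
      (* From this rank on [t + 1/(n+1)] stays below [T] and clamping changes nothing. *)
      have [k Hk] : exists k : nat, k.+1%:R^-1 < T - t.
        have Tt : 0 < T - t by rewrite subr_gt0.
        have := near_infty_natSinv_lt (PosNum Tt) => -[k _ /(_ k (leqnn _)) /= ?].
        by exists k.
      exists k => // n /= kn.
      have nT : n.+1%:R^-1 < T - t.
        by apply: le_lt_trans Hk; rewrite lef_pV2 ?posrE ?ltr0n // ler_nat.
      rewrite /= invrK /a !clampE.
      - by congr (_ * _); ring.
      - by rewrite !ltW.
      - have := n0 n; move: nT; move: (n.+1%:R^-1) => x h1 h2.
        by apply/andP; split; lra.
    rewrite is_cvg_limn_einfE; last by apply/cvg_ex; exists (dF t)%:E.
    by rewrite (cvg_lim _ cv) // lee_fin; have /andP[] := gdF _ tT.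
apply: (le_trans (fatou _ mD mf f0)).
apply: limn_einf_le => n.
by apply: integral_quotient_le => // t; rewrite amono // lerDl ltW.
Qed.

End increment.

(** * Solutions of the scheme *)

Section solution.
Context {R : realType} {N : nat} {Omega : set 'rV[R]_N} (M : mesh Omega).
Variables (gamma alpha h T : R) (mu : R -> iface M -> R).
Variables (rho : R -> cell M -> R) (m : R -> cell M -> 'rV[R]_N) (E : R -> cell M -> R).
Variables (theta_up : R).
Let u t := velocity (rho t) (m t).
Let p t := pressure gamma (rho t) (m t) (E t).
Let th t := temperature gamma (rho t) (m t) (E t).
Let ent t := entropy gamma (rho t) (m t) (E t).
Let c := (gamma - 1)^-1.
Let H := h `^ (alpha - 1).
Let drho t K := derive1 (fun t => rho t K) t.
Let dm t K := derive1 (fun t => m t K) t.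
Let dE t K := derive1 (fun t => E t K) t.
Let rate t := entropy_rate gamma (rho t) (m t) (E t) (drho t) (dm t) (dE t).
Hypothesis gamma1 : 1 < gamma.
Hypothesis T0 : 0 < T.
Hypothesis mu0 : forall t s, 0 <= t <= T -> 0 <= mu t s.
Hypothesis sol : is_solution gamma alpha h T mu rho m E.
Hypothesis area0 : forall s, 0 <= area (inl s : iface M + bface M).
Hypothesis vol0 : forall K : cell M, 0 < vol K.
Hypothesis th_bound : forall t K, 0 <= t <= T -> 0 < th t K <= theta_up.

Let c0 : 0 < c. Proof. by rewrite invr_gt0 subr_gt0. Qed.
Let H0 : 0 <= H. Proof. exact: powR_ge0. Qed.
Let rho0 t K : 0 <= t <= T -> 0 < rho t K. Proof. exact: (rho_pos sol). Qed.
Let th0 t K : 0 <= t <= T -> 0 < th t K.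
Proof. by move=> tT; have /andP[] := th_bound K tT. Qed.
Let ooW t : 0 < t < T -> 0 <= t <= T.
Proof. by move=> /andP[/ltW -> /ltW ->]. Qed.

Lemma entropyE t K : 0 <= t <= T -> ent t K = c * ln (th t K) - ln (rho t K).
Proof.
move=> tT; have t0 := th0 K tT; have r0 := rho0 K tT.
by rewrite /ent /entropy -/(th t K) ln_div ?posrE ?powR_gt0 // ln_powR.
Qed.

Lemma is_derive_rho t K : 0 < t < T -> is_derive t 1 (fun t => rho t K) (drho t K).
Proof. by move=> /(rho_derivable sol (K := K)) d; rewrite /drho derive1E; exact/derivableP. Qed.

Lemma is_derive_E t K : 0 < t < T -> is_derive t 1 (fun t => E t K) (dE t K).
Proof. by move=> /(E_derivable sol (K := K)) d; rewrite /dE derive1E; exact/derivableP. Qed.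

Lemma is_derive_m t K i : 0 < t < T ->
  is_derive t 1 (fun t => m t K ord0 i) (dm t K ord0 i).
Proof.
move=> /(m_derivable sol (K := K)) d; rewrite /dm derive1E derive_mx // mxE.
by apply/derivableP; move/derivable_mxP : d; apply.
Qed.

Lemma is_derive_pressure t K : 0 < t < T -> is_derive t 1 (fun t => p t K)
  ((gamma - 1) * (dE t K - dotp (dm t K) (u t K) + 2^-1 * sqnorm (u t K) * drho t K)).
Proof.
move=> tT.
have r0 : rho t K != 0 by rewrite gt_eqF // rho0 // ooW.
have hs : is_derive t 1 (fun t => sqnorm (m t K)) (2 * dotp (dm t K) (m t K)).
  apply: (is_derive_val (is_derive_sum_pt _ (fun i =>
    is_deriveM_pt (is_derive_m K i tT) (is_derive_m K i tT)))).
  by rewrite /dotp mulr_sumr; apply: eq_bigr => i _; ring.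
have hV := is_deriveV_pt r0 (is_derive_rho K tT).
have := is_derive_cmul (gamma - 1) (is_deriveB_pt (is_derive_E K tT)
  (is_deriveM_pt (is_derive_cmul 2^-1 hs) hV)).
move=> /is_derive_val; apply; congr (_ * _).
rewrite /u /velocity /sqnorm dotpZr dotpZl dotpZr; field.
by rewrite r0.
Qed.

Lemma is_derive_entropy t K : 0 < t < T ->
  is_derive t 1 (fun t => ent t K) (rate t K / (th t K * rho t K)).
Proof.
move=> tT; have tT' := ooW tT.
have r0 := rho0 K tT'; have t0 := th0 K tT'.
have pE : p t K = rho t K * th t K by rewrite /th /temperature mulrC divfK // gt_eqF.
have p0 : 0 < p t K by rewrite pE mulr_gt0.
have g1 : gamma - 1 != 0 by rewrite subr_eq0 gt_eqF.
have hr := is_derive_ln_pt (f := fun t => rho t K) r0 (is_derive_rho K tT).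
have hp := is_derive_ln_pt (f := fun t => p t K) p0 (is_derive_pressure K tT).
(* Writing the temperature as [p / rho] expresses the entropy through quantities with known
   derivatives; the logarithm splits only where both are positive, hence the restriction to times
   near [t]. *)
apply: (@near_eq_is_derive _ _ _ (fun t => c * (ln (p t K) - ln (rho t K)) - ln (rho t K))).
  have : \forall s \near t, s \in `]0, T[.
    by apply: near_in_itvoo; rewrite in_itv.
  apply: filterS => s; rewrite in_itv /= => /ooW sT.
  rewrite entropyE // /th /temperature ln_div ?posrE //; first exact: (p_pos sol).
  exact: rho0.
apply: (is_derive_val (is_deriveB_pt (is_derive_cmul c (is_deriveB_pt hp hr)) hr)).
rewrite pE /rate /entropy_rate -/(th t) -/(u t) /c; field.
by rewrite (gt_eqF r0) (gt_eqF t0) g1.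
Qed.

(** * Minimum principle for the entropy *)

Let wi t := wio (mu t) (rho t) (m t).
Let wo t := woi (mu t) (rho t) (m t).

Lemma wio_ge0 t s : 0 <= t <= T -> 0 <= wi t s.
Proof.
move=> tT; apply: addr_ge0; last exact: mu0.
rewrite mulr_ge0 //; set a := avg_n _ s.
by have := ler_norm (- a); rewrite normrN; lra.
Qed.

Lemma woi_ge0 t s : 0 <= t <= T -> 0 <= wo t s.
Proof.
move=> tT; apply: addr_ge0; last exact: mu0.
by rewrite mulr_ge0 // subr_ge0 ler_norm.
Qed.

Lemma solution_balance t psi : 0 < t < T ->
  int_dom (fun K => rate t K * psi K) = int_faces (fun s =>
    psi (inn s) * production c H (wo t s) (rho t (inn s)) (rho t (out s))
       (th t (inn s)) (th t (out s)) (sqnorm (jump (u t) s))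
  + psi (out s) * production c H (wi t s) (rho t (out s)) (rho t (inn s))
       (th t (out s)) (th t (inn s)) (sqnorm (jump (u t) s))).
Proof.
move=> tT; have tT' := ooW tT.
apply: entropy_balance => //.
- by move=> K; exact: rho0.
- by move=> b; exact: (no_flux sol).
- exact: (continuity_sol sol).
- exact: (momentum_sol sol).
- exact: (energy_sol sol).
Qed.

(* Each neighbour L contributes at least th K * w * rho L * (ent L - ent K) >= 0. *)
Lemma entropy_rate_ge0_at_min t K : 0 < t < T -> (forall L, ent t K <= ent t L) ->
  0 <= rate t K.
Proof.
move=> tT Kmin; have tT' := ooW tT.
have prod0 w L : 0 <= w -> forall J, 0 <= J ->
    0 <= production c H w (rho t K) (rho t L) (th t K) (th t L) J.
  move=> w0 J J0; apply: le_trans (production_ge_transport _ _ _ _ _ _ _ _) => //;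
    try exact: rho0; try exact: th0.
  rewrite -!entropyE //; apply: mulr_ge0; first exact: ltW (th0 K tT').
  apply: mulr_ge0; last by rewrite subr_ge0.
  by apply: mulr_ge0 => //; exact: ltW (rho0 L tT').
have := solution_balance (fun L => (L == K)%:R) tT.
have -> : int_dom (fun L => rate t L * (L == K)%:R) = vol K * rate t K.
  rewrite /int_dom (bigD1 K) //= eqxx mulr1 big1 ?addr0 // => L /negbTE ->.
  by rewrite !mulr0.
move=> B; rewrite -(pmulr_rge0 _ (vol0 K)) B; apply: sumr_ge0 => s _.
apply: mulr_ge0 => //; apply: addr_ge0.
- case: eqP => [->|_]; last by rewrite mul0r.
  by rewrite mul1r prod0 ?woi_ge0 // dotp_ge0.
- case: eqP => [->|_]; last by rewrite mul0r.
  by rewrite mul1r prod0 ?wio_ge0 // dotp_ge0.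
Qed.

Lemma temperature_continuous K : {within `[0, T], continuous (fun t => th t K)}.
Proof.
apply/subspace_continuousP => t /=; rewrite in_itv /= => tT.
have r0 := rho0 K tT.
have tA : `[0, T]%classic t by rewrite /= in_itv.
set F := within _ _.
have FF : ProperFilter F by apply: within_nbhs_proper; exact: subset_closure.
have cr : (fun t => rho t K) @ F --> rho t K.
  have : {within `[0, T], continuous (fun t => rho t K)} by exact: (rho_continuous sol).
  by move=> /subspace_continuousP /(_ t tA).
have cE : (fun t => E t K) @ F --> E t K.
  have : {within `[0, T], continuous (fun t => E t K)} by exact: (E_continuous sol).
  by move=> /subspace_continuousP /(_ t tA).
have cm : (fun t => m t K) @ F --> m t K.
  have : {within `[0, T], continuous (fun t => m t K)} by exact: (m_continuous sol).
  by move=> /subspace_continuousP /(_ t tA).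
have cmi i : (fun t => m t K ord0 i) @ F --> m t K ord0 i.
  apply: (cvg_comp (fun t => m t K) (fun v : 'rV[R]_N => v ord0 i) cm).
  exact: coord_continuous.
have cs : (fun t => sqnorm (m t K)) @ F --> sqnorm (m t K).
  rewrite /sqnorm /dotp; elim: (index_enum _) => [|i s IH].
    rewrite big_nil (_ : (fun t => _) = fun=> 0); first exact: cvg_cst.
    by apply/funext => x; rewrite big_nil.
  rewrite big_cons (_ : (fun t => _) = fun t => m t K ord0 i * m t K ord0 i +
      \sum_(j <- s) m t K ord0 j * m t K ord0 j).
    by apply: cvgD => //; exact: cvgM.
  by apply/funext => x; rewrite big_cons.
have cV : (fun t => (rho t K)^-1) @ F --> (rho t K)^-1 by apply: cvgV => //; rewrite gt_eqF.
rewrite /th /temperature /pressure; apply: cvgM => //; apply: cvgM; first exact: cvg_cst.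
by apply: cvgB => //; apply: cvgM => //; apply: cvgM => //; exact: cvg_cst.
Qed.

Lemma velocity_continuous K i : {within `[0, T], continuous (fun t => u t K ord0 i)}.
Proof.
have -> : (fun t => u t K ord0 i) = (fun s => (rho s K)^-1 * m s K ord0 i).
  by apply/funext => s; rewrite /u /velocity mxE.
apply/subspace_continuousP => t /=; rewrite in_itv /= => tT.
have r0 := rho0 K tT.
have tA : `[0, T]%classic t by rewrite /= in_itv.
set F := within _ _.
have FF : ProperFilter F by apply: within_nbhs_proper; exact: subset_closure.
have cr : (fun t => rho t K) @ F --> rho t K.
  have : {within `[0, T], continuous (fun t => rho t K)} by exact: (rho_continuous sol).
  by move=> /subspace_continuousP /(_ t tA).
have cm : (fun t => m t K) @ F --> m t K.
  have : {within `[0, T], continuous (fun t => m t K)} by exact: (m_continuous sol).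
  by move=> /subspace_continuousP /(_ t tA).
have cV : (fun t => (rho t K)^-1) @ F --> (rho t K)^-1 by apply: cvgV => //; rewrite gt_eqF.
apply: cvgM => //.
by apply: (cvg_comp (fun t => m t K) (fun v : 'rV[R]_N => v ord0 i) cm);
  exact: coord_continuous.
Qed.

Lemma entropy_continuous K : {within `[0, T], continuous (fun t => ent t K)}.
Proof.
apply/subspace_continuousP => t /=; rewrite in_itv /= => tT.
have r0 := rho0 K tT; have t0 := th0 K tT.
have tA : `[0, T]%classic t by rewrite /= in_itv.
set F := within _ _.
have FF : ProperFilter F by apply: within_nbhs_proper; exact: subset_closure.
have cr : (fun t => rho t K) @ F --> rho t K.
  have : {within `[0, T], continuous (fun t => rho t K)} by exact: (rho_continuous sol).
  by move=> /subspace_continuousP /(_ t tA).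
have cth : (fun t => th t K) @ F --> th t K.
  by have /subspace_continuousP /(_ t tA) := @temperature_continuous K.
suff : (fun t => ent t K) @ F --> c * ln (th t K) - ln (rho t K) by rewrite -entropyE.
apply: (@cvg_trans _ ((fun t => c * ln (th t K) - ln (rho t K)) @ F)).
  apply: near_eq_cvg; rewrite /F near_withinE; apply: nearW => s /=.
  by rewrite in_itv /= => sT; rewrite entropyE.
apply: cvgB; first apply: cvgM; first exact: cvg_cst.
- by apply: (cvg_comp (fun t => th t K) (@ln R) cth); exact: continuous_ln.
- by apply: (cvg_comp (fun t => rho t K) (@ln R) cr); exact: continuous_ln.
Qed.

(** The perturbation [d s] makes the argument strict: at a space-time minimum of [z] at positive
    time the entropy rate is nonnegative, so [z] has derivative at least [d > 0], impossible at a
    minimum from the left. The minimum is thus initial; [d = e / t] makes the perturbation at time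
    [t] equal to [e]. *)
Lemma entropy_min_principle s0 t K : (forall K, s0 < ent 0 K) -> 0 < t < T ->
  s0 <= ent t K.
Proof.
move=> s00 /andP[t0 tT].
apply/ler_addgt0Pr => e e0.
pose d := e / t; have d0 : 0 < d by exact: divr_gt0.
pose z L s := ent s L + d * s.
have cz L : {within `[0, t], continuous (z L)}.
  apply: (@continuous_subspaceW _ _ `[0, t]%classic `[0, T]%classic).
    by apply: subset_itvl; rewrite bnd_simp ltW.
  move=> s; apply: cvgD; first exact: entropy_continuous.
  apply: cvgM; first exact: cvg_cst.
  by apply: (@continuous_subspaceT _ _ _ id) => y; exact: cvg_id.
have /choice[tm tmE] L : exists s, s \in `[0, t] /\ forall r, r \in `[0, t] -> z L s <= z L r.
  by have [s ? ?] := EVT_min (ltW t0) (cz L); exists s.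
pose L := [arg min_(L < K) z L (tm L)]%O.
have Lmin L' r : r \in `[0, t] -> z L (tm L) <= z L' r.
  move=> rt; apply: le_trans ((tmE L').2 r rt).
  by rewrite /L; case: arg_minP => // i _ /(_ L' isT).
have tin : t \in `[0, t] by rewrite in_itv /= lexx ltW.
have [] := tmE L; rewrite in_itv /= => /andP[tm0 tmt] _.
have tm_0 : tm L = 0.
  apply/eqP; rewrite eq_le tm0 andbT leNgt; apply/negP => tmp.
  have tmT : 0 < tm L < T by rewrite tmp (le_lt_trans tmt).
  have rate0 : 0 <= rate (tm L) L.
    apply: entropy_rate_ge0_at_min => // L'.
    have : tm L \in `[0, t] by rewrite in_itv /= tm0.
    by move=> /(Lmin L'); rewrite /z lerD2r.
  have hz : is_derive (tm L) 1 (z L) (rate (tm L) L / (th (tm L) L * rho (tm L) L) + d * 1).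
    have hd : is_derive (tm L) 1 (fun s : R => d * s) (d * 1).
      by apply: (is_derive_cmul (f := fun s => s) d); exact: is_derive_id.
    exact: (is_deriveD_pt (is_derive_entropy L tmT) hd).
  have : rate (tm L) L / (th (tm L) L * rho (tm L) L) + d * 1 <= 0.
    apply: (left_min_derive_le0 tmp hz) => r /andP[r0 rt].
    by apply: Lmin; rewrite in_itv /= r0 (le_trans rt).
  rewrite leNgt => /negP; apply; rewrite mulr1 ltr_wpDl // divr_ge0 //.
  by rewrite ltW // mulr_gt0 ?th0 ?rho0 // ooW.
have := Lmin K t tin; rewrite tm_0 /z mulr0 addr0 /d divfK ?gt_eqF //.
by apply: le_trans; exact: ltW.
Qed.

Lemma density_le s0 t K : (forall K, s0 < ent 0 K) -> 0 < t < T ->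
  rho t K <= expR (c * ln theta_up - s0).
Proof.
move=> s00 tT; have tT' := ooW tT.
have r0 := rho0 K tT'; have t0 := th0 K tT'; have /andP[_ tu] := th_bound K tT'.
rewrite -[leLHS]lnK ?posrE // ler_expR.
have := entropy_min_principle K s00 tT; rewrite entropyE //.
have : c * ln (th t K) <= c * ln theta_up.
  by rewrite ler_pM2l // ler_ln ?posrE // (lt_le_trans t0).
by lra.
Qed.

(** * Growth of the total entropy *)

Definition total_entropy t := int_dom (fun K => rho t K * ent t K).
(** The product rule for [rho * ent]: the rate divided by the temperature is [rho] times the
    derivative of the entropy. *)
Definition total_entropy_rate t :=
  int_dom (fun K => rate t K * (th t K)^-1) + int_dom (fun K => drho t K * ent t K).

Lemma is_derive_total_entropy t : 0 < t < T ->
  is_derive t 1 total_entropy (total_entropy_rate t).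
Proof.
move=> tT; have tT' := ooW tT.
apply: (is_derive_val (is_derive_sum_pt (index_enum (cell M)) (fun K =>
  is_derive_cmul (vol K) (is_deriveM_pt (is_derive_rho K tT) (is_derive_entropy K tT))))).
rewrite /total_entropy_rate /int_dom -big_split; apply: eq_bigr => K _ /=.
have r0 : rho t K != 0 by rewrite gt_eqF // rho0.
have t0 : th t K != 0 by rewrite gt_eqF // th0.
by field; rewrite r0 t0.
Qed.

Lemma total_entropy_continuous : {within `[0, T], continuous total_entropy}.
Proof.
apply: (@sum_continuous R (subspace `[0, T]%classic) _ _
  (fun K t => vol K * (rho t K * ent t K))) => K t.
apply: cvgM; first exact: cst_continuous.
apply: cvgM; last exact: entropy_continuous.
exact: (rho_continuous sol).
Qed.

Lemma mass_conserved : int_dom (rho T) = int_dom (rho 0).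
Proof.
have cm : {within `[0, T], continuous (fun t => int_dom (rho t))}.
  apply: (@sum_continuous R (subspace `[0, T]%classic) _ _
    (fun K t => vol K * rho t K)) => K t.
  by apply: cvgM; [exact: cst_continuous|exact: (rho_continuous sol)].
have dm0 t : t \in `]0, T[ -> is_derive t 1 (fun t => int_dom (rho t)) 0.
  rewrite in_itv /= => tT.
  apply: (is_derive_val (is_derive_sum_pt (index_enum (cell M)) (fun K =>
    is_derive_cmul (vol K) (is_derive_rho K tT)))).
  have := continuity_sol sol tT (fun=> 1).
  rewrite /int_faces big1 ?subr0; last by move=> s _; rewrite /jump subrr !mulr0.
  by move=> E1; rewrite -[RHS]E1; apply: eq_bigr => K _; rewrite mulr1.
have [x _] := MVT_segment (df := fun=> 0) (ltW T0) dm0 cm.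
by rewrite mul0r => /eqP; rewrite subr_eq0 => /eqP.
Qed.

(** The entropy is bounded above pointwise at [T] by the bounds on temperature and density, and
    below at 0 by [s0]. Mass conservation gives both bounds the same weight. *)
Lemma total_entropy_increment rho_low s0 : 0 < rho_low ->
  (forall t K, 0 <= t <= T -> rho_low <= rho t K) -> (forall K, s0 < ent 0 K) ->
  total_entropy T - total_entropy 0 <=
    (c * ln theta_up - ln rho_low - s0) * int_dom (rho 0).
Proof.
move=> rl0 rl s00.
have TT : 0 <= T <= T by rewrite lexx ltW.
have zT : 0 <= (0 : R) <= T by rewrite lexx ltW.
rewrite mulrBl; apply: lerB.
- rewrite -mass_conserved /total_entropy /int_dom mulr_sumr; apply: ler_sum => K _.
  rewrite [leRHS]mulrCA; apply: ler_wpM2l; first exact: ltW.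
  rewrite mulrC; apply: ler_wpM2r; first exact: ltW (rho0 K TT).
  rewrite entropyE //; have t0 := th0 K TT; have /andP[_ tu] := th_bound K TT.
  apply: lerB; last by rewrite ler_ln ?posrE ?rho0 // rl.
  by rewrite ler_pM2l // ler_ln ?posrE // (lt_le_trans t0).
- rewrite /total_entropy /int_dom mulr_sumr; apply: ler_sum => K _.
  rewrite mulrCA; apply: ler_wpM2l; first exact: ltW.
  by rewrite mulrC; apply: ler_wpM2l; [exact: ltW (rho0 K zT)|exact: ltW].
Qed.

Let lam t := lambda (mu t) (u t).

Lemma lambda_ge0 t s : 0 <= t <= T -> 0 <= lam t s.
Proof. by move=> tT; rewrite addr_ge0 // mu0. Qed.

(** The continuity equation tested with the entropy turns the second summand of the rate into the
    mass flux times the jump of [ent], which cancels the transport terms [w r1 (s1 - s0)] of the two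
    sides of each face. *)
Lemma total_entropy_rate_ge rho_low rup t : 0 < rho_low -> 0 < t < T ->
  (forall K, rho_low <= rho t K <= rup) ->
  int_faces (fun s => (4 * rup)^-1 * (lam t s * jump (rho t) s ^+ 2)
    + c * rho_low / (4 * theta_up ^+ 2) * (lam t s * jump (th t) s ^+ 2)
    + theta_up^-1 * (H * sqnorm (jump (u t) s))) <= total_entropy_rate t.
Proof.
move=> rl0 tT rb; have tT' := ooW tT.
have := continuity_sol sol tT (ent t) => /eqP; rewrite subr_eq0 => /eqP C.
rewrite /total_entropy_rate (solution_balance (fun K => (th t K)^-1)) // C.
rewrite /int_faces -big_split; apply: ler_sum => s _ /=; rewrite -mulrDr.
apply: ler_wpM2l => //.
set i := inn s; set o := out s.
set J := sqnorm _.
have J0 : 0 <= J by exact: dotp_ge0.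
have [r0i r0o] := (rho0 i tT', rho0 o tT').
have [t0i t0o] := (th0 i tT', th0 o tT').
have /andP[rli rui] := rb i; have /andP[rlo ruo] := rb o.
have /andP[_ tui] := th_bound i tT'; have /andP[_ tuo] := th_bound o tT'.
have wi0 := wio_ge0 s tT'; have wo0 := woi_ge0 s tT'.
have Pi := production_ge_dissipation c0 H0 wo0 J0 r0i r0o t0i t0o rl0 rlo rui ruo tui tuo.
have Po := production_ge_dissipation c0 H0 wi0 J0 r0o r0i t0o t0i rl0 rli ruo rui tuo tui.
rewrite -!entropyE // in Pi Po.
have FE : flux (mu t) (rho t) (velocity (rho t) (m t)) s = wi t s * rho t i - wo t s * rho t o.
  by rewrite /flux /Up /wi /wo /wio /woi /avg /jump -/i -/o; field.
rewrite FE [(th t i)^-1 * _]mulrC [(th t o)^-1 * _]mulrC.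
have rup0 : 0 < rup by exact: lt_le_trans rui.
have tup0 : 0 < theta_up by exact: lt_le_trans tui.
(* The upwind weights add up to [|avg_n u|] plus twice [mu], so one [mu] is given away. *)
have lamE : lam t s <= wi t s + wo t s.
  have := mu0 s tT'; rewrite /lam /lambda /wi /wo /wio /woi -/(u t); lra.
have A0 : 0 <= (rho t o - rho t i) ^+ 2 / (4 * rup).
  by rewrite divr_ge0 ?sqr_ge0 // mulr_ge0 // ltW.
have B0 : 0 <= c * rho_low * (th t o - th t i) ^+ 2 / (4 * theta_up ^+ 2).
  apply: divr_ge0; last by rewrite mulr_ge0 ?sqr_ge0.
  by apply: mulr_ge0; [rewrite mulr_ge0 ?ltW|exact: sqr_ge0].
have A1 := ler_wpM2r A0 lamE; have B1 := ler_wpM2r B0 lamE.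
have sqi x y : (x - y) ^+ 2 = (y - x) ^+ 2 :> R by ring.
rewrite (sqi (rho t i)) (sqi (th t i)) in Po.
have E1 : (4 * rup)^-1 * (lam t s * jump (rho t) s ^+ 2) =
  lam t s * ((rho t o - rho t i) ^+ 2 / (4 * rup)) by rewrite /jump; ring.
have E2 : c * rho_low / (4 * theta_up ^+ 2) * (lam t s * jump (th t) s ^+ 2) =
  lam t s * (c * rho_low * (th t o - th t i) ^+ 2 / (4 * theta_up ^+ 2)).
  by rewrite /jump; ring.
(* Each side of the face supplies half of the viscous term. *)
have E3 : H * J / (2 * theta_up) = 2^-1 * (theta_up^-1 * (H * J)).
  by rewrite invfM; ring.
rewrite E1 E2 -/J; rewrite E3 in Pi Po.
rewrite /jump -/i -/o.
have combine (w w' l X Y Z P P' r r' z z' : R) :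
    w' * r' * (z' - z) + w' * X + w' * Y + 2^-1 * Z <= P ->
    w * r * (z - z') + w * X + w * Y + 2^-1 * Z <= P' ->
    l * X <= (w + w') * X -> l * Y <= (w + w') * Y ->
    l * X + l * Y + Z <= P + P' + (w * r - w' * r') * (z' - z).
  by move=> *; lra.
exact: combine Pi Po A1 B1.
Qed.

(** * Measurability in time and the integrated estimates *)

Hypothesis mmu : forall s, measurable_fun `[0, T] (fun t => mu t s).
Local Notation TT := (`[0, T]%classic : set R).

Lemma measurable_continuous_within (f : R -> R) :
  {within `[0, T], continuous f} -> measurable_fun TT f.
Proof. by move=> cf; apply: subspace_continuous_measurable_fun. Qed.

Lemma measurable_int_faces (f : R -> iface M -> R) :
  (forall s, measurable_fun TT (fun t => f t s)) ->
  measurable_fun TT (fun t => int_faces (f t)).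
Proof.
move=> mf; apply: (@measurable_sum _ _ _ _ _ _ (fun s t => area (inl s) * f t s)) => s.
exact: measurable_funM.
Qed.

Lemma measurable_dotp (f g : R -> 'rV[R]_N) :
  (forall i, measurable_fun TT (fun t => f t ord0 i)) ->
  (forall i, measurable_fun TT (fun t => g t ord0 i)) ->
  measurable_fun TT (fun t => dotp (f t) (g t)).
Proof.
move=> mf mg; apply: (@measurable_sum _ _ _ _ _ _ (fun i t => f t ord0 i * g t ord0 i)) => i.
exact: measurable_funM.
Qed.

Lemma measurable_velocity K i : measurable_fun TT (fun t => u t K ord0 i).
Proof. by apply: measurable_continuous_within; exact: velocity_continuous. Qed.

Lemma measurable_sqnorm_jump s : measurable_fun TT (fun t => sqnorm (jump (u t) s)).
Proof.
have mj i : measurable_fun TT (fun t => jump (u t) s ord0 i).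
  rewrite (_ : (fun t => _) = fun t => u t (out s) ord0 i - u t (inn s) ord0 i).
    by apply: measurable_funB; exact: measurable_velocity.
  by apply/funext => t; rewrite /jump !mxE.
exact: measurable_dotp.
Qed.

Lemma measurable_lambda s : measurable_fun TT (fun t => lam t s).
Proof.
apply: measurable_funD => //.
have ma : measurable_fun TT (fun t => avg_n (u t) s).
  apply: measurable_dotp => i; last exact: measurable_cst.
  rewrite (_ : (fun t => _) = fun t => 2^-1 * (u t (inn s) ord0 i + u t (out s) ord0 i)).
    by apply: measurable_funM => //; apply: measurable_funD; exact: measurable_velocity.
  by apply/funext => t; rewrite /vavg !mxE.
exact: (measurableT_comp (@normr_measurable R setT) ma).
Qed.

Lemma measurable_jump_sqr (f : R -> cell M -> R) s :
  (forall K, {within `[0, T], continuous (fun t => f t K)}) ->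
  measurable_fun TT (fun t => jump (f t) s ^+ 2).
Proof.
move=> cf; apply: measurable_funX.
by apply: measurable_funB; apply: measurable_continuous_within; exact: cf.
Qed.

Lemma integral_le_dissipation (k C : R) (f : R -> iface M -> R) :
  0 < k -> total_entropy T - total_entropy 0 <= C ->
  (forall s, measurable_fun TT (fun t => f t s)) ->
  (forall t s, 0 < t < T -> 0 <= f t s) ->
  (forall t, 0 < t < T -> int_faces (fun s => k * f t s) <= total_entropy_rate t) ->
  (\int[lebesgue_measure]_(t in `[0%R, T]) (int_faces (f t))%:E <= (k^-1 * C)%:E)%E.
Proof.
move=> k0 SC mf f0 fS.
have k1 : 0 <= k^-1 by rewrite invr_ge0 ltW.
apply: (le_trans (@integral_le_increment R T (fun t => k^-1 * total_entropy t)
  (fun t => k^-1 * total_entropy_rate t) (fun t => int_faces (f t)) T0 _ _ _ _)).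
- move=> t; apply: cvgM; [exact: cst_continuous|exact: total_entropy_continuous].
- by move=> t tT; apply: is_derive_cmul; exact: is_derive_total_entropy.
- move=> t tT; apply/andP; split.
    by apply: sumr_ge0 => s _; rewrite mulr_ge0 // f0.
  rewrite mulrC ler_pdivlMr // mulrC; apply: le_trans (fS t tT).
  by rewrite /int_faces mulr_sumr; apply: ler_sum => s _; rewrite mulrCA.
- exact: measurable_int_faces.
- by rewrite lee_fin -mulrBr ler_wpM2l.
Qed.

Lemma dissipation_estimates rho_low s0 mass :
  0 < rho_low -> 0 < theta_up ->
  (forall t K, 0 <= t <= T -> rho_low <= rho t K) -> (forall K, s0 < ent 0 K) ->
  int_dom (rho 0) <= mass ->
  let C := `|c * ln theta_up - ln rho_low - s0| * `|mass| in
  let rup := expR (c * ln theta_up - s0) in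
  [/\ (H%:E * \int[lebesgue_measure]_(t in `[0%R, T])
          (int_faces (fun s => sqnorm (jump (u t) s)))%:E <= (theta_up * C)%:E)%E,
      (\int[lebesgue_measure]_(t in `[0%R, T])
          (int_faces (fun s => lam t s * jump (rho t) s ^+ 2))%:E <= (4 * rup * C)%:E)%E &
      (\int[lebesgue_measure]_(t in `[0%R, T])
          (int_faces (fun s => lam t s * jump (th t) s ^+ 2))%:E
        <= ((c * rho_low / (4 * theta_up ^+ 2))^-1 * C)%:E)%E].
Proof.
move=> rl0 tu0 rl s00 mass0 C rup.
have SC : total_entropy T - total_entropy 0 <= C.
  apply: (le_trans (total_entropy_increment rl0 rl s00)).
  have m0 : 0 <= int_dom (rho 0).
    by apply: sumr_ge0 => K _; rewrite mulr_ge0 ?ltW // rho0 // lexx ltW.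
  apply: (le_trans (ler_wpM2r m0 (ler_norm _))); apply: ler_wpM2l => //.
  exact: le_trans mass0 (ler_norm _).
have rup0 : 0 < rup by exact: expR_gt0.
have rb t K : 0 < t < T -> rho_low <= rho t K <= rup.
  by move=> tT; rewrite rl ?ooW //= density_le.
have D t tT := total_entropy_rate_ge rl0 tT (fun K => rb t K tT).
pose k1 := (4 * rup)^-1; pose k2 := c * rho_low / (4 * theta_up ^+ 2).
have k10 : 0 < k1 by rewrite invr_gt0 mulr_gt0.
have k20 : 0 < k2 by rewrite divr_gt0 ?mulr_gt0 ?exprn_gt0.
have k30 : 0 < theta_up^-1 by rewrite invr_gt0.
have n1 t s : 0 < t < T -> 0 <= lam t s * jump (rho t) s ^+ 2.
  by move=> /ooW tT; rewrite mulr_ge0 ?sqr_ge0 // lambda_ge0.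
have n2 t s : 0 < t < T -> 0 <= lam t s * jump (th t) s ^+ 2.
  by move=> /ooW tT; rewrite mulr_ge0 ?sqr_ge0 // lambda_ge0.
have n3 t s : 0 <= H * sqnorm (jump (u t) s) by rewrite mulr_ge0 // dotp_ge0.
(* The three dissipation terms are nonnegative, so each of them alone is dominated by the entropy
   rate. *)
have pick t (f : iface M -> R) : 0 < t < T ->
    (forall s, f s <= k1 * (lam t s * jump (rho t) s ^+ 2)
      + k2 * (lam t s * jump (th t) s ^+ 2) + theta_up^-1 * (H * sqnorm (jump (u t) s))) ->
    int_faces f <= total_entropy_rate t.
  move=> tT fs; apply: le_trans (D t tT); apply: ler_sum => s _.
  exact: ler_wpM2l.
have q1 t s : 0 < t < T -> 0 <= k1 * (lam t s * jump (rho t) s ^+ 2).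
  by move=> tT; rewrite mulr_ge0 ?n1 // ltW.
have q2 t s : 0 < t < T -> 0 <= k2 * (lam t s * jump (th t) s ^+ 2).
  by move=> tT; rewrite mulr_ge0 ?n2 // ltW.
have q3 t s : 0 <= theta_up^-1 * (H * sqnorm (jump (u t) s)).
  by rewrite mulr_ge0 // ltW.
split.
- have mI := measurable_int_faces measurable_sqnorm_jump.
  rewrite -ge0_integralZl //.
  + have -> : theta_up * C = theta_up^-1^-1 * C by rewrite invrK.
    have L : (\int[lebesgue_measure]_(t in `[0%R, T])
        (int_faces (fun s => H * sqnorm (jump (u t) s)))%:E <= (theta_up^-1^-1 * C)%:E)%E.
      apply: integral_le_dissipation => //.
      * by move=> s; apply: measurable_funM => //; exact: measurable_sqnorm_jump.
      * by move=> t tT; apply: pick => // s; rewrite lerDr addr_ge0 ?q1 ?q2.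
    apply: le_trans L; rewrite le_eqVlt; apply/orP; left; apply/eqP.
    apply: eq_integral => t _; rewrite -EFinM /int_faces mulr_sumr; congr EFin.
    by apply: eq_bigr => s _; rewrite mulrCA.
  + exact/measurable_EFinP.
  + move=> t _; rewrite lee_fin; apply: sumr_ge0 => s _.
    by rewrite mulr_ge0 // dotp_ge0.
- have -> : 4 * rup * C = k1^-1 * C by rewrite invrK.
  apply: integral_le_dissipation => //.
  + move=> s; apply: measurable_funM; first exact: measurable_lambda.
    by apply: measurable_jump_sqr => K; exact: (rho_continuous sol).
  + move=> t tT; apply: pick => // s; rewrite -addrA lerDl addr_ge0 ?q2 //.
- apply: integral_le_dissipation => //.
  + move=> s; apply: measurable_funM; first exact: measurable_lambda.
    by apply: measurable_jump_sqr => K; exact: temperature_continuous.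
  + move=> t tT; apply: pick => // s; rewrite addrAC lerDr addr_ge0 ?q1 //.
Qed.

End solution.

Theorem mainTheorem3 (R : realType) (N : nat) (Omega : set 'rV[R]_N)
  (gamma alpha T : R) (H : set R) (M : R -> mesh Omega)
  (mu : forall h : R, R -> iface (M h) -> R)
  (rho : forall h : R, R -> cell (M h) -> R)
  (m : forall h : R, R -> cell (M h) -> 'rV[R]_N)
  (E : forall h : R, R -> cell (M h) -> R)
  (rho_low theta_up s0 : R) :
  (1 <= N <= 3)%N ->
  open Omega -> connected Omega -> Omega !=set0 ->
  1 < gamma -> 0 < T ->
  (forall h, H h -> 0 < h) -> limit_point H 0 ->
  (exists c1 c2 : R, [/\ 0 < c1, 0 < c2 &
     forall h, H h -> mesh_regular (M h) c1 c2 h]) ->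
  (forall h t s, H h -> 0 <= t <= T -> 0 <= mu h t s) ->
  (forall h s, H h -> measurable_fun `[0, T] (fun t => mu h t s)) ->
  (forall h, H h ->
     is_solution gamma alpha h T (mu h) (rho h) (m h) (E h)) ->
  (forall h K, H h -> 0 < rho h 0 K /\
     0 < E h 0 K - 2^-1 * sqnorm (m h 0 K) / rho h 0 K) ->
  (exists c0 : R, forall h, H h ->
     int_dom (rho h 0) <= c0 /\ int_dom (E h 0) <= c0) ->
  (forall h K, H h -> s0 < entropy gamma (rho h 0) (m h 0) (E h 0) K) ->
  0 < rho_low -> 0 < theta_up ->
  (forall h t K, H h -> 0 <= t <= T -> rho_low <= rho h t K) ->
  (forall h t K, H h -> 0 <= t <= T ->
     0 < temperature gamma (rho h t) (m h t) (E h t) K <= theta_up) ->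
  exists2 c : R, 0 < c & forall h, H h ->
    let u t := velocity (rho h t) (m h t) in
    let theta t := temperature gamma (rho h t) (m h t) (E h t) in
    let lam t := lambda (mu h t) (u t) in
    [/\ ((h `^ (alpha - 1))%:E *
           \int[lebesgue_measure]_(t in `[0%R, T])
             (int_faces (fun s => sqnorm (jump (u t) s)))%:E <= c%:E)%E,
        (\int[lebesgue_measure]_(t in `[0%R, T])
             (int_faces (fun s => lam t s * jump (rho h t) s ^+ 2))%:E
           <= c%:E)%E &
        (\int[lebesgue_measure]_(t in `[0%R, T])
             (int_faces (fun s => lam t s * jump (theta t) s ^+ 2))%:E
           <= c%:E)%E].
Proof.
move=> _ _ _ _ gamma1 T0 H0 _ [c1 [c2 [c10 _ reg]]] mu0 mmu sol _ [mass mb] s0E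
  rl0 tu0 rl tb.
pose cv := (gamma - 1)^-1; have cv0 : 0 < cv by rewrite invr_gt0 subr_gt0.
pose C := `|cv * ln theta_up - ln rho_low - s0| * `|mass|.
have C0 : 0 <= C by rewrite mulr_ge0.
pose rup := expR (cv * ln theta_up - s0).
pose b1 := theta_up * C; pose b2 := 4 * rup * C.
pose b3 := (cv * rho_low / (4 * theta_up ^+ 2))^-1 * C.
have b10 : 0 <= b1 by rewrite mulr_ge0 // ltW.
have b20 : 0 <= b2 by rewrite !mulr_ge0 // ltW // expR_gt0.
have b30 : 0 <= b3.
  by rewrite mulr_ge0 // invr_ge0 divr_ge0 ?mulr_ge0 ?sqr_ge0 // ltW.
(* The sum dominates the three bounds, none of which involves [h]; the 1 makes the constant positive
   when they all vanish. *)
exists (1 + b1 + b2 + b3) => [|h Hh u theta lam]; first by rewrite !ltr_wpDr.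
have [vreg areg] := reg h Hh.
have hp := H0 h Hh.
have vol0 (K : cell (M h)) : 0 < vol K.
  by have /andP[+ _] := vreg K; apply: lt_le_trans; rewrite mulr_gt0 // exprn_gt0.
have area0 (s : iface (M h)) : 0 <= area (inl s : iface (M h) + bface (M h)).
  have /andP[+ _] := areg (inl s); apply: le_trans.
  by rewrite mulr_ge0 ?exprn_ge0 // ltW.
have [e1 e2 e3] := @dissipation_estimates R N Omega (M h) gamma alpha h T (mu h)
  (rho h) (m h) (E h) theta_up gamma1 T0 (fun t s => @mu0 h t s Hh) (sol h Hh) area0 vol0
  (fun t K => @tb h t K Hh) (fun s => mmu h s Hh) rho_low s0 mass rl0 tu0
  (fun t K => @rl h t K Hh) (fun K => s0E h K Hh) (mb h Hh).1.
split.
- by apply: (le_trans e1); rewrite lee_fin -/b1; lra.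
- by apply: (le_trans e2); rewrite lee_fin -/b2; lra.
- by apply: (le_trans e3); rewrite lee_fin -/b3; lra.
Qed.
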